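(* Let $F:(\mathbb{R}^n\setminus\{0\})\times\mathbb{S}^n\to\mathbb{R}$ be continuous, degenerate elliptic, with $F_*(0,0)=F^*(0,0)=0$, and let $f:\mathbb{R}^n\to[0,\infty)$ be Lipschitz continuous and such that $M:=\max_{\mathbb{R}^n} f$ exists and is finite. Consider the Cauchy problem $$u_t+F(Du,D^2u)=f(x)\ \text{ in }\mathbb{R}^n\times(0,\infty),\qquad u(\cdot,0)=u_0\ \text{ on }\mathbb{R}^n. \quad (C)$$ Assume the following. (A1) The comparison principle holds for (C) in the class of bounded functions on $\mathbb{R}^n\times[0,T]$ for each $T>0$. Moreover, for any initial data $u_0\in \mathrm{BUC}(\mathbb{R}^n)$, (C) has a viscosity solution $u\in C(\mathbb{R}^n\times[0,\infty))$ which is bounded on $\mathbb{R}^n\times[0,T]$ for each $T>0$. (A2) For $u_0\equiv 0$, the solution $u$ of (C) is uniformly continuous in $x$ uniformly in $t\ge 0$: there is a continuous, increasing function $\omega:[0,\infty)\to[0,\infty)$ with $\omega(0)=0$ such that $|u(x,t)-u(y,t)|\le\omega(|x-y|)$ for all $x,y\in\mathbb{R}^n$ and $t\ge0$. (A3) For $u_0\equiv0$, let $u$ be the corresponding solution of (C). There exists $R_0>0$ such that for each $T>0$ there is $(x_T,s_T)\in\overline{B}(0,R_0)\times[0,T]$ with $u(x_T,s_T)=\max_{\mathbb{R}^n\times[0,T]}u$. Then there exists $c\in[0,M]$, independent of the choice of $u_0$, such that for every $u_0\in\mathrm{BUC}(\mathbb{R}^n)$ the solution $u$ of (C) with initial data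 $u_0$ satisfies $$\lim_{t\to\infty}\frac{u(x,t)}{t}=c\quad\text{locally uniformly for }x\in\mathbb{R}^n.$$
   Context: $\mathbb{S}^n$ is the space of real symmetric $n\times n$ matrices. $\mathrm{BUC}(\mathbb{R}^n)$ is the set of bounded uniformly continuous functions on $\mathbb{R}^n$. $\overline B(0,R)$ is the closed ball of radius $R$ centered at $0$. $F$ is degenerate elliptic if $F(p,X+Y)\le F(p,X)$ for all $p\in\mathbb{R}^n\setminus\{0\}$ and $X,Y\in\mathbb{S}^n$ with $Y\ge0$. $F_*$ and $F^*$ denote the lower and upper semicontinuous envelopes of $F$ on $\mathbb{R}^n\times\mathbb{S}^n$. Solutions are viscosity solutions: an upper semicontinuous $u$ is a subsolution of the equation if, whenever $u-\varphi$ has a local maximum at $(x_0,t_0)$, $t_0>0$, for a $C^2$ function $\varphi$, one has $\varphi_t+F_*(D\varphi,D^2\varphi)\le f$ at $(x_0,t_0)$; a lower semicontinuous $u$ is a supersolution if, whenever $u-\varphi$ has a local minimum at $(x_0,t_0)$, $t_0>0$, one has $\varphi_t+F^*(D\varphi,D^2\varphi)\ge f$ at $(x_0,t_0)$; a solution is both. The comparison principle in the class of bounded functions on $\mathbb{R}^n\times[0,T]$ says: if $v$ is a bounded subsolution and $w$ a bounded supersolution on $\mathbb{R}^n\times[0,T]$ with $v(\cdot,0)\le w(\cdot,0)$, then $v\le w$ on $\mathbb{R}^n\times[0,T]$. ''The solution'' means the one given by (A1), which is unique among functions bounded on each $\mathbb{R}^n\times[0,T]$. *)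

(* Defs.v *)
From HB Require Import structures.
From mathcomp Require Import all_boot all_order all_algebra.
From mathcomp Require Import all_classical all_reals all_analysis.
Set Implicit Arguments.
Unset Strict Implicit.
Unset Printing Implicit Defensive.
Import Order.TTheory GRing.Theory Num.Theory.
Import numFieldNormedType.Exports.
Local Open Scope classical_set_scope.
Local Open Scope ring_scope.

(* Points of R^n are row vectors and points of space-time R^n x R are pairs    *)
(* (x, t).  A function on a subset A of a type is a total function of which    *)
(* only the values on A are ever used.                                         *)

(* The library norm on 'rV[R]_n is the sup norm, so |x| is defined here; the   *)
(* two norms give the same topology and the same uniform structure.            *)
Definition enorm (R : realType) (n : nat) (x : 'rV[R]_n) : R :=
  Num.sqrt (\sum_(i < n) x 0 i ^+ 2).

Definition psd (R : realType) (n : nat) (Y : 'M[R]_n) : Prop :=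
  Y^T = Y /\ forall v : 'rV[R]_n, 0 <= (v *m Y *m v^T) 0 0.

(* (R^n \ {0}) x S^n *)
Definition Fdom (R : realType) (n : nat) : set ('rV[R]_n * 'M[R]_n) :=
  [set z | z.1 != 0 /\ z.2^T = z.2].

Definition degenerate_elliptic (R : realType) (n : nat)
    (F : 'rV[R]_n * 'M[R]_n -> R) : Prop :=
  forall (p : 'rV[R]_n) (X Y : 'M[R]_n),
    p != 0 -> X^T = X -> psd Y -> F (p, X + Y) <= F (p, X).

(* F_* and F^*: liminf and limsup of F over points of (R^n \ {0}) x S^n that   *)
(* tend to (p, X), the point (p, X) itself included when p != 0.  They may be  *)
(* infinite when p = 0.                                                        *)
Definition lenv (R : realType) (n : nat) (F : 'rV[R]_n * 'M[R]_n -> R)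
    (z : 'rV[R]_n * 'M[R]_n) : \bar R :=
  limf_einf (EFin \o F) (within (@Fdom R n) (nbhs z)).

Definition uenv (R : realType) (n : nat) (F : 'rV[R]_n * 'M[R]_n -> R)
    (z : 'rV[R]_n * 'M[R]_n) : \bar R :=
  limf_esup (EFin \o F) (within (@Fdom R n) (nbhs z)).

Definition xdir (R : realType) (n : nat) (i : 'I_n) : 'rV[R]_n * R :=
  (delta_mx 0 i, 0).

Definition tdir (R : realType) (n : nat) : 'rV[R]_n * R := (0, 1).

Definition coord_dirs (R : realType) (n : nat) : set ('rV[R]_n * R) :=
  range (@xdir R n) `|` [set tdir R n].

Definition C1_on (R : realType) (n : nat) (O : set ('rV[R]_n * R))
    (phi : 'rV[R]_n * R -> R) : Prop :=
  forall v, coord_dirs v -> forall z, O z ->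
    derivable phi z v /\ {for z, continuous ('D_v phi)}.

(* For open O: the partial derivatives of orders 1 and 2 exist and are         *)
(* continuous on O.                                                            *)
Definition C2_on (R : realType) (n : nat) (O : set ('rV[R]_n * R))
    (phi : 'rV[R]_n * R -> R) : Prop :=
  C1_on O phi /\ forall v, coord_dirs v -> C1_on O ('D_v phi).

(* Test functions are C^2 on R^n x (0, oo). *)
Definition test_function (R : realType) (n : nat)
    (phi : 'rV[R]_n * R -> R) : Prop :=
  C2_on [set z | 0 < z.2] phi.

Definition dt (R : realType) (n : nat) (phi : 'rV[R]_n * R -> R)
    (z : 'rV[R]_n * R) : R := 'D_(tdir R n) phi z.

Definition grad (R : realType) (n : nat) (phi : 'rV[R]_n * R -> R)
    (z : 'rV[R]_n * R) : 'rV[R]_n := \row_(i < n) 'D_(xdir R i) phi z.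

Definition hess (R : realType) (n : nat) (phi : 'rV[R]_n * R -> R)
    (z : 'rV[R]_n * R) : 'M[R]_n :=
  \matrix_(i < n, j < n) 'D_(xdir R j) ('D_(xdir R i) phi) z.

(* R^n x J, for a set J of times *)
Definition cyl (R : realType) (n : nat) (J : set R) : set ('rV[R]_n * R) :=
  [set z | J z.2].

Definition lsc_on (R : realType) (T : topologicalType) (A : set T)
    (u : T -> R) : Prop :=
  lower_semicontinuous (EFin \o u : subspace A -> \bar R).

Definition usc_on (R : realType) (T : topologicalType) (A : set T)
    (u : T -> R) : Prop := lsc_on A (\- u).

Definition local_max_on (R : realType) (T : topologicalType) (A : set T)
    (g : T -> R) (z : T) : Prop :=
  \forall y \near within A (nbhs z), g y <= g z.

Definition local_min_on (R : realType) (T : topologicalType) (A : set T)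
    (g : T -> R) (z : T) : Prop :=
  \forall y \near within A (nbhs z), g z <= g y.

(* Extrema are local relative to R^n x J.  In particular, for J = [0, T] the   *)
(* contact time t0 = T is allowed, and only times t <= T are then compared.    *)
Definition subsolution (R : realType) (n : nat) (F : 'rV[R]_n * 'M[R]_n -> R)
    (f : 'rV[R]_n -> R) (J : set R) (u : 'rV[R]_n * R -> R) : Prop :=
  usc_on (cyl J) u /\
  forall (phi : 'rV[R]_n * R -> R) (z : 'rV[R]_n * R),
    test_function phi -> cyl J z -> 0 < z.2 ->
    local_max_on (cyl J) (u \- phi) z ->
    ((dt phi z)%:E + lenv F (grad phi z, hess phi z) <= (f z.1)%:E)%E.

Definition supersolution (R : realType) (n : nat)
    (F : 'rV[R]_n * 'M[R]_n -> R) (f : 'rV[R]_n -> R) (J : set R)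
    (u : 'rV[R]_n * R -> R) : Prop :=
  lsc_on (cyl J) u /\
  forall (phi : 'rV[R]_n * R -> R) (z : 'rV[R]_n * R),
    test_function phi -> cyl J z -> 0 < z.2 ->
    local_min_on (cyl J) (u \- phi) z ->
    ((f z.1)%:E <= (dt phi z)%:E + uenv F (grad phi z, hess phi z))%E.

Definition bounded_on (R : realType) (T : Type) (A : set T)
    (u : T -> R) : Prop :=
  exists K : R, forall z, A z -> `|u z| <= K.

Definition BUC (R : realType) (n : nat) (u0 : 'rV[R]_n -> R) : Prop :=
  bounded_on setT u0 /\ unif_continuous u0.

Definition comparison_principle (R : realType) (n : nat)
    (F : 'rV[R]_n * 'M[R]_n -> R) (f : 'rV[R]_n -> R) (T : R) : Prop :=
  forall v w : 'rV[R]_n * R -> R,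
    bounded_on (cyl `[0, T]) v -> bounded_on (cyl `[0, T]) w ->
    subsolution F f `[0, T] v -> supersolution F f `[0, T] w ->
    (forall x, v (x, 0) <= w (x, 0)) ->
    forall z, cyl `[0, T] z -> v z <= w z.

Definition cauchy_solution (R : realType) (n : nat)
    (F : 'rV[R]_n * 'M[R]_n -> R) (f : 'rV[R]_n -> R) (u0 : 'rV[R]_n -> R)
    (u : 'rV[R]_n * R -> R) : Prop :=
  [/\ {within cyl `[0, +oo[, continuous u},
      subsolution F f `[0, +oo[ u,
      supersolution F f `[0, +oo[ u,
      forall x, u (x, 0) = u0 x &
      forall T : R, 0 < T -> bounded_on (cyl `[0, T]) u].

(* Main.v *)
Require Import Defs.
From HB Require Import structures.
From mathcomp Require Import all_boot all_order all_algebra.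
From mathcomp Require Import all_classical all_reals all_analysis.
From mathcomp Require Import ring lra.

(** Only the solution [u] with zero initial data matters, because by comparison two
   solutions differ by at most the distance of their initial data.  Restarting [u]
   at time [s] from data between [0] and [max u(., s)] and comparing shows that [u]
   is nondecreasing in time and that [U t = max u(., t)] is subadditive, so
   [U t / t] converges by Fekete's lemma.  Monotonicity and (A3) put a maximum
   point of [u(., t)] in a fixed ball, and then (A2) bounds [U t - u(x, t)] for
   [x] in a compact set uniformly in [t].

   Two points need care.  The comparison principle is applied on [0, T] with
   contact at [t = T] allowed, so that solutions have to be tested at the final
   time as well.  And [0] and [M t] are compared with [u] by a maximum principle
   with an explicit penalty rather than by the comparison principle: this uses
   only [F_*(0, 0) = F^*(0, 0) = 0] and avoids the second order conditions at
   extrema of arbitrary test functions. *)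

Set Implicit Arguments.
Unset Strict Implicit.
Unset Printing Implicit Defensive.
Import Order.TTheory GRing.Theory Num.Theory.
Import numFieldNormedType.Exports.
Local Open Scope classical_set_scope.
Local Open Scope ring_scope.

(** * Test functions *)

Section Separable.
Context {R : realType} {n : nat}.
Implicit Types (a : 'I_n -> R -> R) (b : R -> R) (z v : 'rV[R]_n * R).

(** All explicit perturbations of test functions below have this form: their derivatives reduce to
    one-variable ones and their Hessian is diagonal. *)
Definition separable a b z : R := \sum_(i < n) a i (z.1 0 i) + b z.2.

Lemma continuous_coord (i : 'I_n) :
  continuous (fun z : 'rV[R]_n * R => z.1 0 i).
Proof.
move=> z; apply: (@continuous_comp _ _ _ fst (fun x : 'rV[R]_n => x 0 i)).
  exact: cvg_fst.
exact: coord_continuous.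
Qed.

(** As [l] is affine along the line through [z], the two difference quotients coincide. *)
Lemma is_derive_line {V : normedModType R} (l : V -> R) (g : R -> R)
    (dg : R) (z v : V) :
  (forall (h : R), l (h *: v + z) = h * l v + l z) ->
  is_derive (l z) (l v) g dg -> is_derive z v (g \o l) dg.
Proof.
move=> lE [dg1 dg2].
have E : (fun h : R => h^-1 *: (((g \o l) \o shift z) (h *: v) - (g \o l) z))
   = (fun h : R => h^-1 *: ((g \o shift (l z)) (h *: l v) - g (l z))).
  by apply/funext => h /=; rewrite lE.
by split; rewrite /derivable /derive E.
Qed.

Lemma is_derive_scale (g : R -> R) (s c d : R) :
  is_derive s 1 g d -> is_derive s c g (c * d).
Proof.
move=> [dg gd].
have df : differentiable g s by exact/derivable1_diffP.
split; first exact: diff_derivable.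
rewrite deriveE// -gd deriveE//.
by rewrite -[in LHS](mulr1 c) -[c * 1]/(c *: (1 : R)) linearZ.
Qed.

Lemma coord_line (i : 'I_n) z v (h : R) :
  (h *: v + z).1 0 i = h * v.1 0 i + z.1 0 i.
Proof. by rewrite /= !mxE. Qed.

Lemma is_derive_separable a b z v (da : 'I_n -> R) (db : R) :
  (forall i, is_derive (z.1 0 i) 1 (a i) (da i)) -> is_derive z.2 1 b db ->
  is_derive z v (separable a b) (\sum_(i < n) v.1 0 i * da i + v.2 * db).
Proof.
move=> Ha Hb.
have -> : separable a b = (\sum_(i < n) (a i \o fun z => z.1 0 i)) + (b \o snd).
  by apply/funext => y; rewrite /separable fctE fct_sumE.
apply: is_deriveD.
  apply: is_derive_sum => i.
  apply: is_derive_line => [h|]; first by rewrite coord_line.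
  exact: is_derive_scale.
by apply: is_derive_line => //; exact: is_derive_scale.
Qed.

Lemma is_derive_along (p : 'rV[R]_n * R -> R) z v (r : R) :
  derivable p (r *: v + z) v ->
  is_derive r 1 (fun s => p (s *: v + z)) ('D_v p (r *: v + z)).
Proof.
have E : (fun h : R => h^-1 *: (((fun s => p (s *: v + z)) \o shift r) (h *: 1) -
      p (r *: v + z))) =
    (fun h : R => h^-1 *: ((p \o shift (r *: v + z)) (h *: v) - p (r *: v + z))).
  by apply/funext => h /=; rewrite -[h *: 1]/(h * 1) mulr1 scalerDl addrA.
by move=> d; split; rewrite /derivable /derive E.
Qed.

(** Mean value theorem on the segment; [Num.min] and [Num.max] cover both signs of [h]. *)
Lemma increment_le (p : 'rV[R]_n * R -> R) z v (h C : R) :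
  (forall r : R, Num.min 0 h <= r <= Num.max 0 h ->
    derivable p (r *: v + z) v /\ `|'D_v p (r *: v + z)| <= C) ->
  `|p (h *: v + z) - p z| <= C * `|h|.
Proof.
move=> H; pose g s := p (s *: v + z).
have dg (r : R) : Num.min 0 h <= r <= Num.max 0 h -> is_derive r 1 g ('D_v p (r *: v + z)).
  by move=> /H[d _]; exact: is_derive_along.
have mM : Num.min 0 h <= Num.max 0 h by rewrite ge_min le_max lexx.
have [||c cI E] := @MVT_segment R g (fun r => 'D_v p (r *: v + z)) _ _ mM.
- by move=> x /[!in_itv]/= /andP[? ?]; apply: dg; rewrite !ltW.
- apply: derivable_within_continuous => x; rewrite in_itv/= => xI.
  by case: (dg x xI).
have -> : `|p (h *: v + z) - p z| = `|g (Num.max 0 h) - g (Num.min 0 h)|.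
  have -> : p z = g 0 by rewrite /g scale0r add0r.
  by case: (leP 0 h) => // _; rewrite distrC.
rewrite E normrM ler_pM//; first by apply: (H c _).2; rewrite in_itv/= in cI.
by case: (leP 0 h) => _; rewrite ?subr0// sub0r normrN.
Qed.

Lemma norm_coord_le (x : 'rV[R]_n) (i : 'I_n) : `|x 0 i| <= `|x|.
Proof.
rewrite [leRHS]mx_normrE; apply: le_trans (le_bigmax _ _ (ord0, i)) => //=.
Qed.

(* The increment is split into steps parallel to the axes, to each of which the
   mean value theorem applies. *)
Lemma C1_on_continuous (O : set ('rV[R]_n * R)) (p : 'rV[R]_n * R -> R) z :
  open O -> C1_on O p -> O z -> {for z, continuous p}.
Proof.
move=> oO Hp Oz.
pose bnd v (C : R) := \forall y \near z, O y /\ `|'D_v p y| <= C.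
have bex v : coord_dirs v -> exists2 C : R, 0 <= C & bnd v C.
  move=> dv; exists (`|'D_v p z| + 1) => //.
  have [_ /cvgr_dist_le/(_ 1 ltr01) H] := Hp v dv z Oz.
  near=> y; split; first by near: y; exact: open_nbhs_nbhs.
  have : `|'D_v p z - 'D_v p y| <= 1 by near: y.
  by move: (ler_normB ('D_v p z) ('D_v p z - 'D_v p y)); rewrite subKr => *; lra.
have [Ct Ct0 HCt] := bex (tdir R n) (or_intror erefl).
have xd i : coord_dirs (xdir R i : 'rV[R]_n * R) by left; exists i.
have /choice[Cx Hx] : forall i : 'I_n, exists C : R, 0 <= C /\ bnd (xdir R i) C.
  by move=> i; have [C ? ?] := bex _ (xd i); exists C.
have HCx : nbhs z [set y | forall i : 'I_n, O y /\ `|'D_(xdir R i) p y| <= Cx i].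
  by apply: (@filter_forall _ _ _ (nbhs z) (nbhs_filter z)) => i; exact: (Hx i).2.
have [e /= e0 He] := iffLR (@nbhs_ballP R _ z _) (filterI HCt HCx).
have ballE (y : 'rV[R]_n * R) : (forall j, `|z.1 0 j - y.1 0 j| < e) -> `|z.2 - y.2| < e -> ball z e y.
  move=> y1 y2; split; last exact: y2.
  by split => // i j; rewrite (ord1 i); exact: y1.
have lip (y : 'rV[R]_n * R) : ball z e y -> `|p y - p z| <= (\sum_(i < n) Cx i + Ct) * `|y - z|.
  move=> [[_ y1] y2].
  have d1 i : `|y.1 0 i - z.1 0 i| <= `|y - z|.
    have := norm_coord_le (y - z).1 i; rewrite !mxE => /le_trans; apply.
    by rewrite [leRHS]prod_normE le_max lexx.
  have d2 : `|y.2 - z.2| <= `|y - z|.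
    by rewrite [leRHS]prod_normE le_max lexx orbT.
  (* The path moves one coordinate at a time from [z] to the spatial part of [y]; a last step in
     time leads from [path n] to [y]. *)
  pose path k : 'rV[R]_n * R :=
    (\row_j (if (j < k)%N then y.1 0 j else z.1 0 j), z.2).
  have pathP k : (k <= n)%N ->
      `|p (path k) - p z| <= (\sum_(i < n | (i < k)%N) Cx i) * `|y - z|.
    elim: k => [_|k IH kn].
      rewrite big_pred0// mul0r (_ : path 0 = z) ?subrr ?normr0//.
      by rewrite [RHS]surjective_pairing /path; congr pair; apply/rowP => j; rewrite mxE.
    pose i := Ordinal kn.
    have pS : path k.+1 = (y.1 0 i - z.1 0 i) *: xdir R i + path k.
      congr pair; last by rewrite /= scaler0 add0r.
      apply/rowP => j; rewrite !mxE eqxx/= ltnS leq_eqVlt -val_eqE/= .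
      case: (ltngtP j k) => jk /=; rewrite ?mulr0 ?add0r//.
      have -> : j = i by exact/val_inj.
      by rewrite mulr1 subrK.
    have S : `|p (path k.+1) - p (path k)| <= Cx i * `|y - z|.
      rewrite pS; apply: le_trans (ler_wpM2l (Hx i).1 (d1 i)).
      apply: increment_le => r rI.
      (* Each coordinate of an intermediate point lies between those of [z] and [y], so the point
         stays in the ball where the bounds hold. *)
      have B : ball z e (r *: xdir R i + path k).
        apply: ballE => [j|] /=; last by rewrite scaler0 add0r subrr normr0.
        rewrite !mxE eqxx/= -val_eqE/=.
        case: (ltngtP j k) => jk /=; rewrite ?mulr0 ?add0r ?subrr ?normr0//.
        + by have [] := y1 0 j.
        + have ji : j = i by exact/val_inj.
          rewrite ji mulr1 opprD addrCA subrr addr0 normrN.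
          apply: le_lt_trans (y1 0 i); rewrite distrC.
          move: rI; case: (leP 0 (y.1 0 i - z.1 0 i)) => s0 /andP[r1 r2].
            by rewrite !ger0_norm//.
          by rewrite !ler0_norm ?lerN2// ltW.
      have [_ /(_ i)[OB ?]] := He _ B.
      by split => //; exact: (Hp _ (xd i) _ OB).1.
    rewrite (bigD1 i) ?ltnSn//= mulrDl -(subrKA (p (path k))).
    apply: le_trans (ler_normD _ _) _; apply: lerD => //.
    apply: le_trans (IH (ltnW kn)) _; rewrite le_eqVlt; apply/orP; left; apply/eqP.
    congr (_ * _); apply: eq_bigl => j.
    by rewrite ltnS -val_eqE/=; case: ltngtP.
  have yE : y = (y.2 - z.2) *: tdir R n + path n.
    rewrite [LHS]surjective_pairing; congr pair; last first.
      by rewrite /= -[_ *: 1]/(_ * 1) mulr1 subrK.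
    by apply/rowP => j; rewrite !mxE mulr0 add0r ltn_ord.
  rewrite -(subrKA (p (path n))) mulrDl addrC.
  apply: le_trans (ler_normD _ _) _; apply: lerD.
    by apply: le_trans (pathP n (leqnn n)) _; under eq_bigl do rewrite ltn_ord.
  rewrite [X in p X - _]yE; apply: le_trans (ler_wpM2l Ct0 d2).
  apply: increment_le => r rI.
  have B : ball z e (r *: tdir R n + path n).
    apply: ballE => [j|] /=.
      by rewrite !mxE mulr0 add0r ltn_ord; have [] := y1 0 j.
    rewrite -[_ *: 1]/(_ * 1) mulr1 opprD addrCA subrr addr0 normrN.
    apply: le_lt_trans y2; rewrite distrC.
    move: rI; case: (leP 0 (y.2 - z.2)) => s0 /andP[r1 r2].
      by rewrite !ger0_norm//.
    by rewrite !ler0_norm ?lerN2// ltW.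
  have [[OB ?] _] := He _ B.
  by split => //; exact: (Hp _ (or_intror erefl) _ OB).1.
set L := _ + _ in lip.
have L0 : 0 <= L by rewrite addr_ge0// sumr_ge0// => i _; exact: (Hx i).1.
apply/cvgrPdist_le => eps eps0; near=> y.
have yB : ball z e y by near: y; exact: (@nbhsx_ballx R _ z e e0).
rewrite distrC; apply: le_trans (lip y yB) _.
(* [L] may be zero, hence the divisor [L + 1]. *)
have : `|z - y| < eps / (L + 1).
  near: y; apply: cvgr_dist_lt; first exact: cvg_id.
  by rewrite divr_gt0// ltr_wpDl.
rewrite distrC ltr_pdivlMr ?ltr_wpDl// => /ltW; apply: le_trans.
by rewrite mulrC ler_wpM2l// lerDl.
Unshelve. all: by end_near. Qed.

Lemma sum_xdir (i : 'I_n) (d : 'I_n -> R) :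
  \sum_(j < n) (xdir R i).1 0 j * d j = d i.
Proof.
rewrite (bigD1 i)//= big1 ?addr0 => [|j ji]; rewrite mxE !eqxx/= ?mul1r//.
by rewrite (negbTE ji) mul0r.
Qed.

Lemma is_derive_sep_x a b (a1 : 'I_n -> R -> R) (b1 : R -> R) (i : 'I_n) z :
  (forall i (s : R), is_derive s 1 (a i) (a1 i s)) ->
  (forall (s : R), is_derive s 1 b (b1 s)) ->
  is_derive z (xdir R i) (separable a b) (a1 i (z.1 0 i)).
Proof.
move=> Ha Hb; apply: is_derive_eq; first exact: is_derive_separable.
by rewrite (sum_xdir i (fun j => a1 j (z.1 0 j))) mul0r addr0.
Qed.

Lemma is_derive_sep_t a b (a1 : 'I_n -> R -> R) (b1 : R -> R) z :
  (forall i (s : R), is_derive s 1 (a i) (a1 i s)) ->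
  (forall (s : R), is_derive s 1 b (b1 s)) ->
  is_derive z (tdir R n) (separable a b) (b1 z.2).
Proof.
move=> Ha Hb; apply: is_derive_eq; first exact: is_derive_separable.
by rewrite big1 => [|j _]; rewrite ?add0r ?mul1r//= mxE mul0r.
Qed.

Lemma C1_onD (O : set ('rV[R]_n * R)) (p q : 'rV[R]_n * R -> R) :
  open O -> C1_on O p -> C1_on O q -> C1_on O (p + q).
Proof.
move=> oO Hp Hq v dv z Oz.
have [p1 p2] := Hp v dv z Oz; have [q1 q2] := Hq v dv z Oz.
split; first exact: derivableD.
have E : \forall y \near z, 'D_v (p + q) y = 'D_v p y + 'D_v q y.
  near=> y.
  have Oy : O y by near: y; exact: (open_nbhs_nbhs (conj oO Oz)).
  exact: (deriveD (Hp v dv y Oy).1 (Hq v dv y Oy).1).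
rewrite /prop_for /continuous_at (deriveD p1 q1).
apply: cvg_trans; last exact: (cvgD p2 q2).
by apply: near_eq_cvg; near do apply/esym.
Unshelve. all: by end_near. Qed.

(** Openness of [O] makes the two functions agree near each of its points, hence their derivatives
    too. *)
Lemma C1_on_ext (O : set ('rV[R]_n * R)) (p q : 'rV[R]_n * R -> R) :
  open O -> (forall z, O z -> p z = q z) -> C1_on O p -> C1_on O q.
Proof.
move=> oO pq Hp v dv z Oz.
have E y : O y -> \forall y' \near y, p y' = q y'.
  move=> Oy; near=> y'; apply: pq; near: y'; exact: (open_nbhs_nbhs (conj oO Oy)).
have [p1 p2] := Hp v dv z Oz.
split; first exact: near_eq_derivable (E _ Oz) p1.
rewrite /prop_for /continuous_at -(near_eq_derive v (E _ Oz)).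
apply: cvg_trans p2; apply: near_eq_cvg; near=> y.
apply: near_eq_derive; apply: E; near: y; exact: (open_nbhs_nbhs (conj oO Oz)).
Unshelve. all: by end_near. Qed.

Lemma C2_onD (O : set ('rV[R]_n * R)) (p q : 'rV[R]_n * R -> R) :
  open O -> C2_on O p -> C2_on O q -> C2_on O (p + q).
Proof.
move=> oO [p1 p2] [q1 q2]; split=> [|v dv]; first exact: C1_onD.
apply: (C1_on_ext (p := 'D_v p + 'D_v q) oO); last first.
  exact: (C1_onD oO (p2 v dv) (q2 v dv)).
by move=> z Oz; apply/esym; exact: (deriveD (p1 v dv z Oz).1 (q1 v dv z Oz).1).
Qed.

Lemma C1_on_separable O a b (a1 : 'I_n -> R -> R) (b1 : R -> R) :
  (forall i (s : R), is_derive s 1 (a i) (a1 i s)) ->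
  (forall (s : R), is_derive s 1 b (b1 s)) ->
  (forall i, continuous (a1 i)) -> continuous b1 ->
  C1_on O (separable a b).
Proof.
move=> Ha Hb ca cb v [[i _ <-]|->] z _.
  have H y := is_derive_sep_x i y Ha Hb.
  split; first by case: (H z).
  have -> : 'D_(xdir R i) (separable a b) = a1 i \o (fun z => z.1 0 i).
    by apply/funext => y; case: (H y).
  apply: (@continuous_comp _ _ _ (fun z : 'rV[R]_n * R => z.1 0 i) (a1 i)).
    exact: continuous_coord.
  exact: ca.
have H y := is_derive_sep_t y Ha Hb.
split; first by case: (H z).
have -> : 'D_(tdir R n) (separable a b) = b1 \o snd.
  by apply/funext => y; case: (H y).
by apply: (@continuous_comp _ _ _ snd b1); [exact: cvg_snd|exact: cb].
Qed.

End Separable.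

(** * Perturbing a test function by a separable function *)

Section SeparableTest.
Context {R : realType} {n : nat}.
Variables (a a1 a2 : 'I_n -> R -> R) (b b1 b2 : R -> R).
Hypotheses (Ha : forall i (s : R), is_derive s 1 (a i) (a1 i s))
  (Ha1 : forall i (s : R), is_derive s 1 (a1 i) (a2 i s))
  (Hb : forall (s : R), is_derive s 1 b (b1 s))
  (Hb1 : forall (s : R), is_derive s 1 b1 (b2 s))
  (ca2 : forall i, continuous (a2 i)) (cb2 : continuous b2).

Let cont_of_derive (g g1 : R -> R) :
  (forall (s : R), is_derive s 1 g (g1 s)) -> continuous g.
Proof.
move=> H s; apply: differentiable_continuous.
by apply/derivable1_diffP; case: (H s).
Qed.

Let ca1 i : continuous (a1 i). Proof. exact: cont_of_derive. Qed.
Let cb1 : continuous b1. Proof. exact: cont_of_derive. Qed.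

(** Presents a function of the single coordinate [i] as a separable one, so that [C1_on_separable]
    applies again to the first derivatives. *)
Let only (i j : 'I_n) (g : 'I_n -> R -> R) : R -> R := if j == i then g j else cst 0.

Let only_separable i (g : 'I_n -> R -> R) (z : 'rV[R]_n * R) :
  separable (fun j => only i j g) (cst 0) z = g i (z.1 0 i).
Proof.
rewrite /separable addr0 (bigD1 i)//= /only eqxx big1 ?addr0// => j ji.
by rewrite (negbTE ji).
Qed.

Let Dx_separable i :
  'D_(xdir R i) (separable a b) = separable (fun j => only i j a1) (cst 0).
Proof.
apply/funext => y; rewrite only_separable.
by case: (is_derive_sep_x i y Ha Hb).
Qed.

Let Dt_separable : 'D_(tdir R n) (separable a b) = separable (fun=> cst 0) b1.
Proof.
apply/funext => y; rewrite /separable big1 // add0r.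
by case: (is_derive_sep_t y Ha Hb).
Qed.

Let only_derive i j (s : R) : is_derive s 1 (only i j a1) (only i j a2 s).
Proof. by rewrite /only; case: ifP => _; [exact: Ha1|exact: is_derive_cst]. Qed.

Lemma C2_on_separable O : C2_on O (separable a b).
Proof.
split=> [|v [[i _ <-]|->]]; first exact: C1_on_separable ca1 cb1.
  rewrite Dx_separable.
  apply: (@C1_on_separable _ _ _ _ _ (fun j => only i j a2) (cst 0)) => //.
  + by move=> j; rewrite /only; case: ifP => _; [exact: ca2|move=> ?; exact: cvg_cst].
  + by move=> ?; exact: cvg_cst.
rewrite Dt_separable.
apply: (@C1_on_separable _ _ _ _ _ (fun=> cst 0) b2) => // _ ?; exact: cvg_cst.
Qed.

Variable phi : 'rV[R]_n * R -> R.
Hypothesis phi_test : test_function phi.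

Lemma open_pos_time : open [set z : 'rV[R]_n * R | 0 < z.2].
Proof. by apply: open_comp (@open_gt R 0) => z _; exact: cvg_snd. Qed.

Lemma test_functionD_separable : test_function (phi + separable a b).
Proof.
exact: (C2_onD open_pos_time phi_test (C2_on_separable _)).
Qed.

Variable z : 'rV[R]_n * R.
Hypothesis z_gt0 : 0 < z.2.

Let deriv v : coord_dirs v -> forall y, 0 < y.2 -> derivable phi y v.
Proof. by move=> dv y y0; have [/(_ v dv y y0)[]] := phi_test. Qed.

Let sderiv v : coord_dirs v -> forall y, derivable (separable a b) y v.
Proof. by move=> dv y; have [/(_ v dv y I)[]] := C2_on_separable setT. Qed.

Lemma dtD_separable : dt (phi + separable a b) z = dt phi z + b1 z.2.
Proof.
have dv : coord_dirs (tdir R n) by right.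
rewrite /dt (deriveD (deriv dv z_gt0) (@sderiv _ dv z)).
by congr (_ + _); case: (is_derive_sep_t z Ha Hb).
Qed.

Lemma gradD_separable :
  grad (phi + separable a b) z = grad phi z + \row_i a1 i (z.1 0 i).
Proof.
apply/rowP => i; rewrite !mxE.
have dv : coord_dirs (xdir R i) by left; exists i.
rewrite (deriveD (deriv dv z_gt0) (@sderiv _ dv z)).
by congr (_ + _); case: (is_derive_sep_x i z Ha Hb).
Qed.

Lemma hessD_separable :
  hess (phi + separable a b) z = hess phi z + diag_mx (\row_i a2 i (z.1 0 i)).
Proof.
apply/matrixP => i j; rewrite !mxE.
have dvi : coord_dirs (xdir R i) by left; exists i.
have dvj : coord_dirs (xdir R j) by left; exists j.
(* The first derivatives add up only at positive times, but these form a neighbourhood of [z], which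
   is enough to differentiate again. *)
rewrite (@near_eq_derive _ _ _ _ ('D_(xdir R i) phi + 'D_(xdir R i) (separable a b))).
  have d1 := (phi_test.2 _ dvi _ dvj z z_gt0).1.
  have d2 := ((C2_on_separable setT).2 _ dvi _ dvj z I).1.
  rewrite (deriveD d1 d2).
  congr (_ + _); rewrite Dx_separable.
  have [_ ->] := is_derive_sep_x j z (only_derive i) (fun s => is_derive_cst (0 : R) s 1).
  by rewrite /only eq_sym; case: eqP => [->|].
near=> y; apply: (deriveD (@deriv _ dvi y _) (@sderiv _ dvi y)).
by near: y; exact: open_nbhs_nbhs (conj open_pos_time z_gt0).
Unshelve. all: by end_near. Qed.

End SeparableTest.

(** * One-variable derivatives *)

Section Calculus1.
Context {R : realType}.

Lemma is_derive_pow (k : nat) (c s : R) :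
  is_derive s 1 (fun s => (s - c) ^+ k.+1) (k.+1%:R * (s - c) ^+ k).
Proof.
have -> : (fun s => (s - c) ^+ k.+1) = (shift (- c)) ^+ k.+1.
  by apply/funext => y; rewrite exprfctE.
apply: (is_derive_eq (is_deriveX k.+1 (is_derive_shift s (1 : R) (- c)))).
by rewrite /= /shift -[_ *: 1]/(_ * 1) mulr1.
Qed.

Lemma is_deriveMl (g : R -> R) (k s d : R) :
  is_derive s 1 g d -> is_derive s 1 (fun s => k * g s) (k * d).
Proof. by move=> gd; exact: is_deriveZ. Qed.

Lemma is_derive_expR_affine (k c s : R) :
  is_derive s 1 (fun s => expR (k * (s - c))) (k * expR (k * (s - c))).
Proof.
have h : is_derive s 1 (fun s : R => k * (s - c)) (k * 1).
  exact: is_deriveMl (is_derive_shift _ _ _).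
apply: (is_derive_eq (is_derive1_comp (is_derive_expR _) h)).
by rewrite mulr1 mulrC.
Qed.

End Calculus1.

(** * Semicontinuity, compact boxes and continuity of derivatives *)

Section Topology.
Context {R : realType}.

Lemma cvg_mx {T : Type} (D : set_system T) {FD : Filter D} m n
    (A : T -> 'M[R]_(m, n)) (B : 'M[R]_(m, n)) :
  (forall i j, (fun x => A x i j) @ D --> B i j) -> A @ D --> B.
Proof.
move=> H V [P HP PV].
have : \forall x \near D, forall i j, P i j (A x i j).
  apply: filter_forall => i; apply: filter_forall => j.
  exact: (H i j _ (HP i j)).
by apply: filterS => x Hx; apply: PV => i j; exact: Hx.
Qed.

Lemma lower_semicontinuous_comp {S T : topologicalType} (g : T -> \bar R) (h : S -> T) x :
  lower_semicontinuous g -> {for x, continuous h} ->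
  forall a, (a%:E < g (h x))%E -> \forall y \near x, (a%:E < g (h y))%E.
Proof.
move=> lg ch a /lg[V Vh Vg].
have : nbhs x (h @^-1` V) := ch _ Vh.
by apply: filterS => y; exact: Vg.
Qed.

Lemma lt_fin_between (c : R) (g : \bar R) : (c%:E < g)%E ->
  exists2 a : R, c < a & (a%:E < g)%E.
Proof.
case: g => [g| |//]; last by exists (c + 1); rewrite ?ltry// ltrDl.
by rewrite lte_fin => cg; exists ((c + g) / 2); rewrite ?lte_fin; lra.
Qed.

(** A neighbourhood of [z] whose infimum exceeds [a] is also a neighbourhood of each point of its
    interior, where it bounds the lower limit by the same infimum. *)
Lemma limf_einf_lsc {T : topologicalType} (D : set T) (g : T -> \bar R) :
  lower_semicontinuous (fun z => limf_einf g (within D (nbhs z))).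
Proof.
move=> z a; rewrite limf_einfE => /ereal_sup_gt[_ [V zV <-] aV].
exists [set y | nbhs y (fun y => D y -> V y)].
  by apply: filterS (nbhs_interior zV) => y.
move=> y yV; apply: lt_le_trans aV _; rewrite limf_einfE.
by apply: ereal_sup_ubound; exists V.
Qed.

Lemma compact_box (n : nat) (x : 'rV[R]_n) (r a b : R) :
  compact ([set y : 'rV[R]_n | forall i, `|y 0 i - x 0 i| <= r] `*` `[a, b]).
Proof.
apply: compact_setX; last exact: segment_compact.
rewrite (_ : mkset _ = [set y : 'rV[R]_n | forall i,
    `[x 0 i - r, x 0 i + r]%classic (y 0 i)]).
  by apply: (@rV_compact R n (fun i => `[x 0 i - r, x 0 i + r]%classic)) => i;
    exact: segment_compact.
by apply/seteqP; split => y /= H i; have := H i; rewrite in_itv/= -ler_distlC distrC.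
Qed.

Lemma within_cyl_continuous (n : nat) (u : 'rV[R]_n * R -> R) z :
  {within cyl `[0, +oo[, continuous u} -> 0 < z.2 -> {for z, continuous u}.
Proof.
move=> cu z0.
have : {within [set z : 'rV[R]_n * R | 0 < z.2], continuous u}.
  apply: continuous_subspaceW cu => y /= y0.
  by rewrite /cyl/= in_itv/= ltW.
by rewrite continuous_open_subspace; [apply; rewrite inE|exact: open_pos_time].
Qed.

Lemma nbhs_box (n : nat) (z : 'rV[R]_n * R) (P : set ('rV[R]_n * R)) :
  nbhs z P -> exists2 r : R, 0 < r &
    forall y : 'rV[R]_n * R, (forall i, `|y.1 0 i - z.1 0 i| <= r) -> `|y.2 - z.2| <= r -> P y.
Proof.
move=> /nbhs_ballP[e /= e0 He]; exists (e / 2) => [|y y1 y2]; first by lra.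
apply: He; split; last first.
  by rewrite /ball/= distrC; apply: le_lt_trans y2 _; lra.
split => // i j; rewrite (ord1 i) /ball/= distrC.
by apply: le_lt_trans (y1 j) _; lra.
Qed.

Lemma box_nbhs (n : nat) (z y : 'rV[R]_n * R) (r : R) :
  (forall i, `|y.1 0 i - z.1 0 i| < r) -> `|y.2 - z.2| < r ->
  nbhs y [set x : 'rV[R]_n * R |
    (forall i, `|x.1 0 i - z.1 0 i| < r) /\ `|x.2 - z.2| < r].
Proof.
move=> y1 y2; apply: filterI; last first.
  have /(_ y) c : continuous (fun x : 'rV[R]_n * R => `|x.2 - z.2|).
    by move=> x; apply: cvg_norm; apply: cvgB; [exact: cvg_snd|exact: cvg_cst].
  exact: (c _ (open_nbhs_nbhs (conj (@open_lt R r) y2))).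
apply: (@filter_forall _ _ _ (nbhs y) (nbhs_filter y)) => i.
have /(_ y) c : continuous (fun x : 'rV[R]_n * R => `|x.1 0 i - z.1 0 i|).
  by move=> x; apply: cvg_norm; apply: cvgB; [exact: continuous_coord|exact: cvg_cst].
exact: (c _ (open_nbhs_nbhs (conj (@open_lt R r) (y1 i)))).
Qed.

Lemma test_function_continuous (n : nat) (phi : 'rV[R]_n * R -> R) z :
  test_function phi -> 0 < z.2 -> {for z, continuous phi}.
Proof. by move=> [p1 _]; exact: C1_on_continuous open_pos_time p1. Qed.

Lemma dt_continuous (n : nat) (phi : 'rV[R]_n * R -> R) z :
  test_function phi -> 0 < z.2 -> {for z, continuous (dt phi)}.
Proof. by move=> [p1 _] z0; exact: (p1 (tdir R n) (or_intror erefl) z z0).2. Qed.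

Lemma grad_continuous (n : nat) (phi : 'rV[R]_n * R -> R) z :
  test_function phi -> 0 < z.2 -> {for z, continuous (grad phi)}.
Proof.
move=> [p1 _] z0; apply: cvg_mx => i j; rewrite mxE.
under eq_fun do rewrite mxE.
by apply: (p1 (xdir R j) _ z z0).2; left; exists j.
Qed.

Lemma hess_continuous (n : nat) (phi : 'rV[R]_n * R -> R) z :
  test_function phi -> 0 < z.2 -> {for z, continuous (hess phi)}.
Proof.
move=> [_ p2] z0; apply: cvg_mx => i j; rewrite mxE.
under eq_fun do rewrite mxE.
by apply: (p2 (xdir R i) _ (xdir R j) _ z z0).2; left; eexists.
Qed.

End Topology.

(** * Viscosity subsolutions *)

Section Esub.
Context {R : realType} {n : nat}.
Implicit Types (G : 'rV[R]_n * 'M[R]_n -> \bar R) (f : 'rV[R]_n -> R).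
Implicit Types (u phi : 'rV[R]_n * R -> R) (z : 'rV[R]_n * R) (J : set R).

(** The operator [G] is left free so that the same lemmas serve [lenv F] and, for supersolutions,
    [dual_env F]. *)
Definition esub G f J u : Prop :=
  usc_on (cyl J) u /\
  forall phi z, test_function phi -> cyl J z -> 0 < z.2 ->
    local_max_on (cyl J) (u \- phi) z ->
    ((dt phi z)%:E + G (grad phi z, hess phi z) <= (f z.1)%:E)%E.

Lemma esub_separable G f J u (a a1 a2 : 'I_n -> R -> R) (b b1 b2 : R -> R) phi z :
  (forall i (s : R), is_derive s 1 (a i) (a1 i s)) ->
  (forall i (s : R), is_derive s 1 (a1 i) (a2 i s)) ->
  (forall s : R, is_derive s 1 b (b1 s)) ->
  (forall s : R, is_derive s 1 b1 (b2 s)) ->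
  (forall i, continuous (a2 i)) -> continuous b2 ->
  esub G f J u -> test_function phi -> cyl J z -> 0 < z.2 ->
  local_max_on (cyl J) (u \- (phi + separable a b)) z ->
  ((dt phi z + b1 z.2)%:E + G ((grad phi z + \row_i a1 i (z.1 0 i))%R,
    (hess phi z + diag_mx (\row_i a2 i (z.1 0 i)))%R) <= (f z.1)%:E)%E.
Proof.
move=> Ha Ha1 Hb Hb1 ca2 cb2 [_ subu] tphi Jz z0 lmax.
have := subu _ z (test_functionD_separable Ha Ha1 Hb Hb1 ca2 cb2 tphi) Jz z0 lmax.
rewrite (dtD_separable Ha Ha1 Hb Hb1 ca2 cb2 tphi z0).
rewrite (gradD_separable Ha Ha1 Hb Hb1 ca2 cb2 tphi z0).
by rewrite (hessD_separable Ha Ha1 Hb Hb1 ca2 cb2 tphi z0).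
Qed.

(** The exponent 4 makes the first and second derivatives vanish at [z]: subtracting it makes a
    maximum at [z] strict without changing the gradient and the Hessian there. *)
Definition quartic z : 'rV[R]_n * R -> R :=
  separable (fun i s => (s - z.1 0 i) ^+ 4) (fun s => (s - z.2) ^+ 4).

Lemma quartic_refl z : quartic z z = 0.
Proof.
by rewrite /quartic /separable subrr expr0n/= addr0 big1// => i _; rewrite subrr expr0n.
Qed.

Lemma pow4_ge0 (x : R) : 0 <= x ^+ 4. Proof. exact: exprn_even_ge0. Qed.

Lemma quartic_lt z (y : 'rV[R]_n * R) (r : R) : 0 <= r -> quartic z y < r ^+ 4 ->
  (forall i, `|y.1 0 i - z.1 0 i| < r) /\ `|y.2 - z.2| < r.
Proof.
move=> r0 q.
have sum0 (P : pred 'I_n) : 0 <= \sum_(i < n | P i) (y.1 0 i - z.1 0 i) ^+ 4.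
  by apply: sumr_ge0 => i _; exact: pow4_ge0.
have lt4 (x : R) : x ^+ 4 < r ^+ 4 -> `|x| < r.
  rewrite -(ger0_norm (pow4_ge0 x)) normrX => x4.
  by rewrite ltNge; apply/negP => rx; move: x4; rewrite ltNge lerXn2r// nnegrE.
split=> [i|]; apply: lt4; apply: le_lt_trans q; rewrite /quartic /separable.
  by rewrite (bigD1 i)//= -addrA lerDl addr_ge0 ?sum0 ?pow4_ge0.
by rewrite lerDr sum0.
Qed.

(** The exponential term equals [K^-1] at time [z.2], has a positive time derivative, and at any
    fixed later time grows without bound with [K]. *)
Definition barrier z (K : R) : 'rV[R]_n * R -> R :=
  separable (fun i s => (s - z.1 0 i) ^+ 4)
    (fun s => (s - z.2) ^+ 4 + K^-1 * expR (K * (s - z.2))).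

Lemma barrierE z K (y : 'rV[R]_n * R) :
  barrier z K y = quartic z y + K^-1 * expR (K * (y.2 - z.2)).
Proof. by rewrite /barrier /quartic /separable addrA. Qed.

Let a1 z (i : 'I_n) (s : R) : R := 4 * (s - z.1 0 i) ^+ 3.
Let a2 z (i : 'I_n) (s : R) : R := 4 * (3 * (s - z.1 0 i) ^+ 2).

Let da z (i : 'I_n) (s : R) : is_derive s 1 (fun s : R => (s - z.1 0 i) ^+ 4) (a1 z i s).
Proof. exact: is_derive_pow. Qed.

Let da1 z (i : 'I_n) (s : R) : is_derive s 1 (a1 z i) (a2 z i s).
Proof. exact: (is_deriveMl 4 (is_derive_pow 2 _ s)). Qed.

Let ca2 z (i : 'I_n) : continuous (a2 z i).
Proof.
move=> s; do 2 (apply: cvgM; first exact: cvg_cst).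
by apply: cvgM; (apply: cvgB; [exact: cvg_id|exact: cvg_cst]).
Qed.

Let b1 z (K s : R) : R := 4 * (s - z.2) ^+ 3 + expR (K * (s - z.2)).
Let b2 z (K s : R) : R := 4 * (3 * (s - z.2) ^+ 2) + K * expR (K * (s - z.2)).

Let db z (K s : R) : 0 < K -> is_derive s 1
  (fun s : R => (s - z.2) ^+ 4 + K^-1 * expR (K * (s - z.2))) (b1 z K s).
Proof.
move=> K0; apply: is_deriveD; first exact: is_derive_pow.
apply: (is_derive_eq (is_deriveMl K^-1 (is_derive_expR_affine K z.2 s))).
by rewrite mulrA mulVf ?mul1r// gt_eqF.
Qed.

Let db1 z (K s : R) : is_derive s 1 (b1 z K) (b2 z K s).
Proof.
apply: is_deriveD; last exact: is_derive_expR_affine.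
exact: (is_deriveMl 4 (is_derive_pow 2 _ s)).
Qed.

Let cb2 z (K : R) : continuous (b2 z K).
Proof.
move=> s; have c : {for s, continuous (fun s => s - z.2)}.
  by apply: cvgB; [exact: cvg_id|exact: cvg_cst].
apply: cvgD.
  do 2 (apply: cvgM; first exact: cvg_cst).
  by apply: cvgM; exact: c.
apply: cvgM; first exact: cvg_cst.
apply: (@continuous_comp _ _ _ (fun s => K * (s - z.2)) expR);
  last exact: continuous_expR.
by apply: cvgM; [exact: cvg_cst|exact: c].
Qed.

(* Adding [exp(K(t - t0))/K] to the test function costs nothing in the
   inequality, since it increases in t, but pushes the maximum point of
   [u - phi], taken without restriction on t, back towards [t <= t0] as K grows. *)
Lemma esub_le_time G f u phi z :
  lower_semicontinuous G -> continuous f ->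
  {within cyl `[0, +oo[, continuous u} -> esub G f `[0, +oo[ u ->
  test_function phi -> 0 < z.2 -> local_max_on (cyl `[0, z.2]) (u \- phi) z ->
  ((dt phi z)%:E + G (grad phi z, hess phi z) <= (f z.1)%:E)%E.
Proof.
move=> lG cf cu subu tphi z0 lmax; rewrite leNgt; apply/negP => Hlt.
(* The level [a] leaves room on both sides, so the strict inequality survives near [z]. *)
have /lt_fin_between[a fa aG] :
    ((f z.1 - dt phi z)%:E < G (grad phi z, hess phi z))%E.
  by move: Hlt; rewrite EFinB lteBlDr// addeC.
pose gr (y : 'rV[R]_n * R) := grad phi y + \row_i a1 z i (y.1 0 i).
pose he (y : 'rV[R]_n * R) := hess phi y + diag_mx (\row_i a2 z i (y.1 0 i)).
have cgr : {for z, continuous gr}.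
  apply: cvgD; first exact: grad_continuous.
  apply: cvg_mx => i j; rewrite mxE; under eq_fun do rewrite mxE.
  apply: (@continuous_comp _ _ _ (fun z : 'rV[R]_n * R => z.1 0 j) (a1 z j)).
    exact: continuous_coord.
  apply: differentiable_continuous; apply/derivable1_diffP.
  by case: (da1 z j (z.1 0 j)).
have che : {for z, continuous he}.
  apply: cvgD; first exact: hess_continuous.
  apply: cvg_mx => i j; rewrite !mxE; under eq_fun do rewrite !mxE.
  case: (i == j); last by under eq_fun do rewrite mulr0n; exact: cvg_cst.
  apply: (@continuous_comp _ _ _ (fun z : 'rV[R]_n * R => z.1 0 i) (a2 z i)).
    exact: continuous_coord.
  exact: ca2.
have grz : gr z = grad phi z.
  by apply/rowP => i; rewrite !mxE /a1 subrr expr0n/= mulr0 addr0.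
have hez : he z = hess phi z.
  apply/matrixP => i j; rewrite !mxE /a2 subrr expr0n/= !mulr0.
  by rewrite mul0rn addr0.
(* Testing [u] with [phi + barrier z K] at [y] bounds [G (gr y, he y)] by [lo y] minus a positive
   exponential, which is impossible where [lo y < a < G (gr y, he y)]. *)
pose lo (y : 'rV[R]_n * R) := f y.1 - dt phi y - 4 * (y.2 - z.2) ^+ 3.
have clo : {for z, continuous lo}.
  apply: cvgB; last first.
    apply: (@continuous_comp _ _ _ snd (fun s => 4 * (s - z.2) ^+ 3)).
      exact: cvg_snd.
    apply: differentiable_continuous; apply/derivable1_diffP.
    by case: (is_deriveMl 4 (is_derive_pow 2 z.2 z.2)).
  apply: cvgB; last exact: dt_continuous.
  by apply: (@continuous_comp _ _ _ fst f); [exact: cvg_fst|exact: cf].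
have good1 : nbhs z [set y | lo y < a].
  apply: (clo _ (open_nbhs_nbhs (conj (@open_lt R a) _))).
  by rewrite /= /lo subrr expr0n/= mulr0 subr0.
have good2 : nbhs z [set y | (a%:E < G (gr y, he y))%E].
  apply: (@lower_semicontinuous_comp _ _ _ G (fun y => (gr y, he y))) => //.
    by have := cvg_pair cgr che; apply.
  by rewrite grz hez.
have good3 : nbhs z [set y | cyl `[0, z.2] y -> (u \- phi) y <= (u \- phi) z].
  exact: lmax.
have good4 : nbhs z [set y : 'rV[R]_n * R | 0 < y.2].
  exact: open_nbhs_nbhs (conj open_pos_time z0).
have [r r0 good] := nbhs_box (filterI (filterI good1 good2) (filterI good3 good4)).
pose B := [set y : 'rV[R]_n | forall i, `|y 0 i - z.1 0 i| <= r] `*`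
  `[z.2 - r, z.2 + r]%classic.
have BP y : B y -> [/\ lo y < a, (a%:E < G (gr y, he y))%E,
    y.2 <= z.2 -> (u \- phi) y <= (u \- phi) z & 0 < y.2].
  move=> [B1 /=]; rewrite in_itv/= -ler_distlC distrC => B2.
  have [[g1 g2] [g3 g4]] := good y B1 B2; split => // yz; apply: g3.
  by rewrite /cyl/= in_itv/= yz ltW.
have cB : compact B by exact: compact_box.
have Bz : B z.
  split=> [i|]; first by rewrite subrr normr0 ltW.
  by rewrite /= in_itv/= gerBl lerDl ltW.
have B0 : B !=set0 by exists z.
pose h y := (u \- phi) y - quartic z y.
have hz : h z = (u \- phi) z by rewrite /h quartic_refl subr0.
have cexp (K : R) (y : 'rV[R]_n * R) :
    {for y, continuous (fun y : 'rV[R]_n * R => K^-1 * expR (K * (y.2 - z.2)))}.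
  apply: cvgM; first exact: cvg_cst.
  apply: (@continuous_comp _ _ _ (fun y : 'rV[R]_n * R => K * (y.2 - z.2)) expR);
    last exact: continuous_expR.
  apply: cvgM; first exact: cvg_cst.
  by apply: cvgB; [exact: cvg_snd|exact: cvg_cst].
have tb K : 0 < K -> test_function (phi + barrier z K).
  move=> K0; exact: (test_functionD_separable (da z) (da1 z) (fun s => db z s K0)
    (db1 z K) (@ca2 z) (@cb2 z K) tphi).
have cq y : {for y, continuous (quartic z)}.
  apply: (@C1_on_continuous _ _ setT) => //; first exact: openT.
  apply: (C1_on_separable (da z) (fun s => is_derive_pow 3 z.2 s)).
    move=> i s; apply: differentiable_continuous; apply/derivable1_diffP.
    by case: (da1 z i s).
  by move=> s; apply: differentiable_continuous; apply/derivable1_diffP;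
    case: (is_deriveMl 4 (is_derive_pow 2 z.2 s)).
have ch y : B y -> {for y, continuous h}.
  move=> /BP[_ _ _ y0]; apply: cvgB; last exact: cq.
  apply: cvgB; first exact: within_cyl_continuous.
  exact: test_function_continuous.
(* Compactness turns "late or low" on the boundary of [B] into uniform gaps. *)
have [d d0 dP] : exists2 d : R, 0 < d & forall y, B y ->
    [\/ quartic z y < r ^+ 4, z.2 + d <= y.2 | h y <= h z - r ^+ 4 / 2].
  (* [m] is positive where one of the three alternatives holds strictly; its minimum over the
     compact [B] is the gap [d]. *)
  pose m := (fun y : 'rV[R]_n * R => y.2 - z.2) \max
    ((fun y => h z - r ^+ 4 / 2 - h y) \max (fun y => r ^+ 4 - quartic z y)).
  have [|y] := @compact_EVT_min _ _ m B B0 cB.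
    apply: continuous_in_subspaceT => y; rewrite inE => By.
    apply: continuous_max; last apply: continuous_max.
    - by apply: cvgB; [exact: cvg_snd|exact: cvg_cst].
    - by apply: cvgB; [exact: cvg_cst|exact: ch].
    - by apply: cvgB; [exact: cvg_cst|exact: cq].
  rewrite inE => By my; suff m0 : 0 < m y.
    exists (m y) => // x Bx.
    have := my x; rewrite inE => /(_ Bx); rewrite {2}/m /= !le_max.
    by move=> /or3P[H|H|H]; [constructor 2|constructor 3|constructor 1]; lra.
  (* If [y] is neither late nor inside, the local maximum gives [h y <= h z - r ^+ 4], twice the
     drop required. *)
  rewrite /m /= !lt_max !subr_gt0; have [_ _ le_z _] := BP y By.
  have [//|yz] := ltP z.2 y.2; have [|qy] := ltP (quartic z y) (r ^+ 4).
    by rewrite orbT.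
  have r4 : 0 < r ^+ 4 by rewrite exprn_gt0.
  by rewrite /h quartic_refl; move: (le_z yz) => /= ?; apply/orP; left; lra.
have [|y1 By1 hy1] := @compact_EVT_max _ _ h B B0 cB.
  by apply: continuous_in_subspaceT => y; rewrite inE => /ch.
have hzy1 : h z <= h y1 by apply: hy1; rewrite inE.
have r4 : 0 < r ^+ 4 by rewrite exprn_gt0.
have d2 : 0 < d ^+ 2 by rewrite exprn_gt0.
(* The second term gives [K^-1 < r ^+ 4 / 2] and excludes low points; the third makes
   [K * d ^+ 2 / 2] exceed the possible gain [h y1 - h z] by 1 and excludes late ones. *)
pose K := 1 + 2 / r ^+ 4 + 2 * (h y1 - h z + 1) / d ^+ 2.
have K2 : 0 <= 2 * (h y1 - h z + 1) / d ^+ 2 by rewrite divr_ge0 ?(ltW d2)//; lra.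
have K1 : 0 < 2 / r ^+ 4 by rewrite divr_gt0.
have K0 : 0 < K by rewrite /K; lra.
have Kr : K^-1 < r ^+ 4 / 2.
  by rewrite -[ltRHS]invrK ltf_pV2 ?posrE ?invr_gt0 ?divr_gt0// invf_div /K; lra.
have Kd : h y1 - h z + 1 <= K * d ^+ 2 / 2.
  have : 2 * (h y1 - h z + 1) <= K * d ^+ 2 by rewrite -ler_pdivrMr// /K; lra.
  lra.
pose g (y : 'rV[R]_n * R) := K^-1 * expR (K * (y.2 - z.2)).
have g0 y : 0 < g y by rewrite /g mulr_gt0 ?invr_gt0 ?expR_gt0.
have gz : g z = K^-1 by rewrite /g subrr mulr0 expR0 mulr1.
have [|y2 By2 hy2] := @compact_EVT_max _ _ (h \- g) B B0 cB.
  apply: continuous_in_subspaceT => y; rewrite inE => By.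
  by apply: cvgB; [exact: ch|exact: cexp].
have hz2 : h z - K^-1 <= h y2 - g y2 by rewrite -gz; apply: hy2; rewrite inE.
rewrite inE in By2; have [in2|late|low] := dP y2 By2.
(* The maximum point is interior to [B], hence a contact point unrestricted in time, and the
   equation is contradicted there. *)
- have [lo2 G2 _ y20] := BP y2 By2.
  have [q1 q2] := quartic_lt (ltW r0) in2.
  have Cy : cyl `[0, +oo[ y2 by rewrite /cyl/= in_itv/= ltW.
  have lm : local_max_on (cyl `[0, +oo[) (u \- (phi + barrier z K)) y2.
    move: (box_nbhs q1 q2); apply: filterS => y [b1y b2y] _; have By : B y.
      split=> [i|]; first exact/ltW/b1y.
      by rewrite /= in_itv/= -ler_distlC distrC ltW.
    have E (x : 'rV[R]_n * R) : (u \- (phi + barrier z K)) x = (h \- g) x.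
      have -> : (u \- (phi + barrier z K)) x = u x - (phi x + barrier z K x) by [].
      by rewrite barrierE /h /g /=; ring.
    by have := hy2 y; rewrite inE -!E; apply.
  have := esub_separable (da z) (da1 z) (fun s => db z s K0) (db1 z K) (@ca2 z)
    (@cb2 z K) subu tphi Cy y20 lm.
  apply/negP; rewrite -ltNge; apply: lt_le_trans (leeD2l _ (ltW G2)).
  rewrite -EFinD lte_fin; move: lo2; rewrite /lo /b1.
  by have := expR_gt0 (K * (y2.2 - z.2)); lra.
(* At a late point, [exp x >= 1 + x ^+ 2 / 2] with [x = K * d] makes the penalty larger than [h] can
   compensate. *)
- have gl : K^-1 * (1 + (K * d) ^+ 2 / 2`!%:R) <= g y2.
    apply: ler_wpM2l; first by rewrite invr_ge0 ltW.
    have Kd0 : 0 <= K * d by rewrite mulr_ge0 ?ltW.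
    apply: le_trans (expR_ge1Dxn 1 Kd0) _.
    rewrite ler_expR; apply: ler_wpM2l; first exact: ltW.
    by rewrite lerBrDl.
  have E : K^-1 * (1 + (K * d) ^+ 2 / 2`!%:R) = K^-1 + K * d ^+ 2 / 2.
    by rewrite (_ : 2`! = 2%N)//; field; rewrite gt_eqF.
  have : h y2 <= h y1 by apply: hy1; rewrite inE.
  rewrite E in gl; lra.
- by have := g0 y2; lra.
Qed.

End Esub.

(** * Restricting, shifting and gluing subsolutions *)

Section Closure.
Context {R : realType} {n : nat}.
Implicit Types (G : 'rV[R]_n * 'M[R]_n -> \bar R) (f : 'rV[R]_n -> R).
Implicit Types (u v phi : 'rV[R]_n * R -> R) (z : 'rV[R]_n * R) (J : set R).

Lemma usc_onP (A : set ('rV[R]_n * R)) u :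
  usc_on A u <-> forall z, A z -> forall a, u z < a ->
    nbhs z [set y | A y -> u y < a].
Proof.
split=> [H z Az a uza|H z a].
  have [|V zV HV] := H z (- a); first by rewrite lte_fin ltrN2.
  have {}zV : within A (nbhs z) V by rewrite (nbhs_subspace_in Az).
  apply: filterS zV => y /HV; rewrite lte_fin /=.
  by rewrite ltrN2.
rewrite lte_fin /= ltrNr => uza; have [Az|nAz] := pselect (A z).
  exists [set y | u y < - a]; last by move=> y /=; rewrite lte_fin ltrNr.
  have : within A (nbhs (z : 'rV[R]_n * R)) [set y | u y < - a] := H z Az _ uza.
  by rewrite (@nbhs_subspace_in ('rV[R]_n * R)%type A z Az).
(* Outside [A] the subspace topology is discrete, so the singleton is a neighbourhood. *)
exists [set z]; last by move=> y /= ->; rewrite lte_fin ltrNr.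
have : globally [set (z : 'rV[R]_n * R)] [set z] by move=> ?.
by rewrite (@nbhs_subspace_out ('rV[R]_n * R)%type A z nAz).
Qed.

Lemma usc_on_continuous (A : set ('rV[R]_n * R)) u :
  {within A, continuous u} -> usc_on A u.
Proof.
move=> cu; apply/usc_onP => z Az a uza.
have : nbhs_subspace (z : subspace A) [set y | u y < a].
  exact: cu z _ (open_nbhs_nbhs (conj (@open_lt R a) uza)).
by rewrite -(nbhs_subspace_in Az).
Qed.

Lemma local_maxE (A : set ('rV[R]_n * R)) (g : 'rV[R]_n * R -> R) z :
  local_max_on A g z = nbhs z [set y | A y -> g y <= g z].
Proof. by []. Qed.

(** A maximum relative to times up to [T] is one relative to times up to [z.2], which [esub_le_time]
    handles; this covers contact at [T]. *)
Lemma esub_restrict G f u (T : R) :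
  lower_semicontinuous G -> continuous f ->
  {within cyl `[0, +oo[, continuous u} -> esub G f `[0, +oo[ u ->
  esub G f `[0, T] u.
Proof.
move=> lG cf cu subu; split.
  apply: usc_on_continuous; apply: continuous_subspaceW cu => y.
  by rewrite /cyl/= !in_itv/= => /andP[->].
move=> phi z tphi; rewrite {1}/cyl/= in_itv/= => /andP[_ zT] z0.
rewrite local_maxE => lmax; apply: (esub_le_time lG cf cu subu tphi z0).
rewrite local_maxE; apply: filterS lmax => y H; rewrite /cyl/= in_itv/= => /andP[y0 yz].
by apply: H; rewrite /cyl/= in_itv/= y0 (le_trans yz).
Qed.

Lemma esub_addc G f J u (c : R) : esub G f J u -> esub G f J (fun z => u z + c).
Proof.
move=> [ucu subu]; split.
  apply/usc_onP => z Az a; rewrite -ltrBrDr => /(iffLR (usc_onP _ _) ucu z Az).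
  by apply: filterS => y H Ay; rewrite -ltrBrDr; exact: H.
move=> phi z tphi Jz z0; rewrite local_maxE => lmax; apply: subu => //.
rewrite local_maxE; apply: filterS lmax => y H /H /=.
by rewrite -!addrA ![c + _]addrC !addrA lerD2r.
Qed.

(* Solutions are glued rather than restarted: a restart [u (x, t + s)] would be
   tested by functions translated backward in time, and these need not be C^2 on
   all positive times. *)
Definition concat (s : R) u v z : R :=
  if z.2 <= s then u z else v (z.1, z.2 - s).

Lemma derive_translate_at phi (w d y z : 'rV[R]_n * R) : z = y + w ->
  'D_d phi z = 'D_d (fun y => phi (y + w)) y.
Proof. by move=> ->; rewrite /derive /=; under [in RHS]eq_fun do rewrite -addrA. Qed.

Lemma derive_translate phi (w d : 'rV[R]_n * R) :
  'D_d (fun y => phi (y + w)) = (fun y => 'D_d phi (y + w)).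
Proof. by apply/funext => y; exact/esym/derive_translate_at. Qed.

Lemma C1_on_translate (O O' : set ('rV[R]_n * R)) phi (w : 'rV[R]_n * R) :
  (forall y, O y -> O' (y + w)) -> C1_on O' phi -> C1_on O (fun y => phi (y + w)).
Proof.
move=> OO' H d dd y Oy; have [H1 H2] := H d dd _ (OO' _ Oy); split.
  by move: H1; rewrite /derivable /=; under [in X in _ -> X]eq_fun do rewrite -addrA.
rewrite derive_translate.
have c : {for y, continuous (fun y : 'rV[R]_n * R => y + w)}.
  by apply: cvgD; [exact: cvg_id|exact: cvg_cst].
pose tr (y : 'rV[R]_n * R) := y + w.
have cc := @continuous_comp _ _ _ tr ('D_d phi) y c H2.
exact: cc.
Qed.

Lemma C2_on_translate (O O' : set ('rV[R]_n * R)) phi (w : 'rV[R]_n * R) :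
  (forall y, O y -> O' (y + w)) -> C2_on O' phi -> C2_on O (fun y => phi (y + w)).
Proof.
move=> OO' [p1 p2]; split=> [|d dd]; first exact: C1_on_translate p1.
by rewrite derive_translate; exact: C1_on_translate (p2 d dd).
Qed.

(** The jump at time [s] is downward, which keeps the glued function upper semicontinuous. A contact
    up to time [s] restricts to one for [u], possibly at its final time; a later one is translated
    to a contact for [v]. *)
Lemma esub_concat G f (s T : R) u v : 0 < s -> 0 <= T ->
  esub G f `[0, s] u -> esub G f `[0, T] v ->
  (forall x, v (x, 0) <= u (x, s)) -> esub G f `[0, s + T] (concat s u v).
Proof.
move=> s0 T0 [/usc_onP uu subu] [/usc_onP uv subv] vu; split.
  apply/usc_onP => z; rewrite /cyl/= in_itv/= => /andP[z0 zT] a wza.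
  have hu : z.2 <= s -> nbhs z [set y | cyl `[0, s + T] y -> y.2 <= s -> u y < a].
    move=> zs; move: wza; rewrite /concat zs => /(uu z) H.
    have /H : cyl `[0, s] z by rewrite /cyl/= in_itv/= z0.
    apply: filterS => y Hy; rewrite /cyl/= in_itv/= => /andP[y0 _] ys.
    by apply: Hy; rewrite /cyl/= in_itv/= y0.
  have hv : s <= z.2 ->
      nbhs z [set y | cyl `[0, s + T] y -> s < y.2 -> v (y.1, y.2 - s) < a].
    move=> sz; have vza : v (z.1, z.2 - s) < a.
      move: wza; rewrite /concat; case: ifP => // zs.
      have zE : z.2 = s by apply/le_anti; rewrite zs sz.
      rewrite zE subrr; apply: le_lt_trans.
      by rewrite [z]surjective_pairing zE.
    pose back (y : 'rV[R]_n * R) : 'rV[R]_n * R := (y.1, y.2 - s).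
    have Cz : cyl `[0, T] (back z).
      by rewrite /cyl/= in_itv/= subr_ge0 sz lerBlDl.
    have c : {for z, continuous back}.
      have c1 : {for z, continuous (fun y : 'rV[R]_n * R => y.1)} by exact: cvg_fst.
      have c2 : {for z, continuous (fun y : 'rV[R]_n * R => y.2 - s)}.
        by apply: cvgB; [exact: cvg_snd|exact: cvg_cst].
      by have := cvg_pair c1 c2; apply.
    have : nbhs z (back @^-1` [set y | cyl `[0, T] y -> v y < a]).
      exact: c _ (uv _ Cz _ vza).
    apply: filterS => y /= Hy; rewrite /cyl/= in_itv/= => /andP[_ yT] sy.
    by apply: Hy; rewrite /cyl/= in_itv/= subr_ge0 ltW//= lerBlDl.
  have csnd : {for z, continuous (fun y : 'rV[R]_n * R => y.2)} by exact: cvg_snd.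
  have [zs|sz|zs] := ltgtP z.2 s.
  - have zn : nbhs z [set y : 'rV[R]_n * R | y.2 < s].
      exact: csnd _ (open_nbhs_nbhs (conj (@open_lt R s) zs)).
    apply: filterS (filterI zn (hu (ltW zs))) => y [ys Hy] Cy.
    by rewrite /concat ltW//; apply: Hy => //; exact: ltW.
  - have zn : nbhs z [set y : 'rV[R]_n * R | s < y.2].
      exact: csnd _ (open_nbhs_nbhs (conj (@open_gt R s) sz)).
    apply: filterS (filterI zn (hv (ltW sz))) => y [ys Hy] Cy.
    by rewrite /concat leNgt ys/=; apply: Hy.
  - have le1 : z.2 <= s by rewrite zs.
    have le2 : s <= z.2 by rewrite zs.
    apply: filterS (filterI (hu le1) (hv le2)) => y [Hu Hv] Cy.
    by rewrite /concat; case: (leP y.2 s) => ys; [exact: (Hu Cy ys)|exact: (Hv Cy ys)].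
move=> phi z tphi; rewrite {1}/cyl/= in_itv/= => /andP[z0' zT] z0.
rewrite local_maxE => lmax.
have [zs|sz] := leP z.2 s.
  apply: subu => //; first by rewrite /cyl/= in_itv/= z0'.
  rewrite local_maxE; apply: filterS lmax => y H; rewrite /cyl/= in_itv/= => /andP[y0 ys].
  have := H _; rewrite /cyl/= in_itv/= y0 /concat ys zs; apply.
  by rewrite (le_trans ys)// lerDl.
pose w : 'rV[R]_n * R := (0, s).
pose z' : 'rV[R]_n * R := (z.1, z.2 - s).
have zE : z = z' + w.
  by rewrite [LHS]surjective_pairing; congr pair; rewrite /= ?addr0 ?subrK.
(* Positive times are shifted beyond [s], where [phi] is smooth, so [psi] is smooth at all positive
   times. *)
pose psi y := phi (y + w).
have tpsi : test_function psi.
  by apply: C2_on_translate tphi => y /= y0; rewrite addr_gt0.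
have -> : dt phi z = dt psi z' by exact: (derive_translate_at phi (tdir R n) zE).
have -> : grad phi z = grad psi z'.
  by apply/rowP => i; rewrite !mxE; exact: (derive_translate_at phi (xdir R i) zE).
have -> : hess phi z = hess psi z'.
  apply/matrixP => i j; rewrite [LHS]mxE [RHS]mxE.
  have -> : 'D_(xdir R i) psi = (fun y => 'D_(xdir R i) phi (y + w)).
    exact: derive_translate.
  exact: (derive_translate_at ('D_(xdir R i) phi) (xdir R j) zE).
apply: (subv psi z' tpsi).
- by rewrite /cyl/= in_itv/= subr_ge0 ltW//= lerBlDl.
- by rewrite /= subr_gt0.
have c : {for z', continuous (fun y : 'rV[R]_n * R => y + w)}.
  by apply: cvgD; [exact: cvg_id|exact: cvg_cst].
(* Near [z'] times are positive, and there the translated glued function is [v]. *)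
have zn : nbhs z' [set y : 'rV[R]_n * R | 0 < y.2].
  by apply: open_nbhs_nbhs; split; [exact: open_pos_time|rewrite /= subr_gt0].
rewrite zE in lmax.
have lmax' : nbhs z' [set y | cyl `[0, s + T] (y + w) ->
    (concat s u v \- phi) (y + w) <= (concat s u v \- phi) (z' + w)] := c _ lmax.
rewrite local_maxE; apply: filterS (filterI zn lmax') => y [y0 H]; rewrite /cyl/= in_itv/= => /andP[_ yT].
have Cyw : cyl `[0, s + T] (y + w).
  by rewrite /cyl/= in_itv/= addr_ge0 ?(ltW y0) ?(ltW s0)//= addrC lerD2l.
have tw (x : 'rV[R]_n * R) : 0 < x.2 -> concat s u v (x + w) = v x.
  move=> x0; rewrite /concat /= leNgt ltrDr x0/=.
  by rewrite [x in RHS]surjective_pairing; congr (v (_, _)); rewrite ?addr0 ?addrK.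
have := H Cyw; rewrite /= !tw//.
by rewrite /= subr_gt0.
Qed.

End Closure.

(** * Supersolutions as negated subsolutions *)

Section Duality.
Context {R : realType} {n : nat}.
Implicit Types (F : 'rV[R]_n * 'M[R]_n -> R) (f : 'rV[R]_n -> R).
Implicit Types (u phi : 'rV[R]_n * R -> R) (z : 'rV[R]_n * R) (J : set R).

(* The operator of the equation solved by [- u]: it turns supersolutions into
   subsolutions, so that only subsolutions need to be treated. *)
Definition dual_env F (q : 'rV[R]_n * 'M[R]_n) : \bar R :=
  (- uenv F ((- q.1)%R, (- q.2)%R))%E.

Lemma lenv_lsc F : lower_semicontinuous (lenv F).
Proof. exact: limf_einf_lsc. Qed.

(** Minus an upper limit is the lower limit of [- F], composed here with the continuous map
    [opp]. *)
Lemma dual_env_lsc F : lower_semicontinuous (dual_env F).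
Proof.
pose opp (q : 'rV[R]_n * 'M[R]_n) : 'rV[R]_n * 'M[R]_n := (- q.1, - q.2).
pose g (q : 'rV[R]_n * 'M[R]_n) :=
  limf_einf (\- (EFin \o F))%E (within (@Fdom R n) (nbhs q)).
have -> : dual_env F = g \o opp.
  by apply/funext => q; rewrite /dual_env /uenv -limf_einfN.
have lg : lower_semicontinuous g by exact: limf_einf_lsc.
have co : continuous opp.
  move=> q.
  have c1 : {for q, continuous (fun q : 'rV[R]_n * 'M[R]_n => - q.1)}.
    by apply: cvgN; exact: cvg_fst.
  have c2 : {for q, continuous (fun q : 'rV[R]_n * 'M[R]_n => - q.2)}.
    by apply: cvgN; exact: cvg_snd.
  by have := cvg_pair c1 c2; apply.
by move=> x a /lg[V Vh Vg]; exists (opp @^-1` V) => [|y /Vg//]; exact: co.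
Qed.

Lemma C1_onN (O : set ('rV[R]_n * R)) phi : open O -> C1_on O phi -> C1_on O (- phi).
Proof.
move=> oO H v dv z Oz; have [H1 H2] := H v dv z Oz.
split; first exact: derivableN.
rewrite /prop_for /continuous_at (deriveN H1).
apply: cvg_trans; last exact: (cvgN H2).
apply: near_eq_cvg; near=> y; apply/esym/deriveN.
have Oy : O y by near: y; exact: (open_nbhs_nbhs (conj oO Oz)).
exact: (H v dv y Oy).1.
Unshelve. all: by end_near. Qed.

Lemma C2_onN (O : set ('rV[R]_n * R)) phi : open O -> C2_on O phi -> C2_on O (- phi).
Proof.
move=> oO [p1 p2]; split=> [|v dv]; first exact: C1_onN.
apply: (C1_on_ext (p := - 'D_v phi) oO); last exact: (C1_onN oO (p2 v dv)).
by move=> z Oz; exact/esym/(deriveN (p1 v dv z Oz).1).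
Qed.

Lemma test_functionN phi : test_function phi -> test_function (- phi).
Proof. exact: C2_onN open_pos_time. Qed.

Lemma derive_testN phi (v z : 'rV[R]_n * R) :
  test_function phi -> coord_dirs v -> 0 < z.2 ->
  'D_v (- phi) z = - 'D_v phi z.
Proof. by move=> [p1 _] dv z0; exact: deriveN (p1 v dv z z0).1. Qed.

Lemma coord_xdir (i : 'I_n) : coord_dirs (xdir R i).
Proof. by left; exists i. Qed.

Lemma dtN phi z : test_function phi -> 0 < z.2 -> dt (- phi) z = - dt phi z.
Proof. by move=> tphi z0; apply: derive_testN => //; right. Qed.

Lemma gradN phi z : test_function phi -> 0 < z.2 -> grad (- phi) z = - grad phi z.
Proof.
move=> tphi z0; apply/rowP => i; rewrite !mxE.
by apply: derive_testN => //; exact: coord_xdir.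
Qed.

Lemma hessN phi z : test_function phi -> 0 < z.2 -> hess (- phi) z = - hess phi z.
Proof.
move=> tphi z0; apply/matrixP => i j; rewrite !mxE.
rewrite (@near_eq_derive _ _ _ _ (- 'D_(xdir R i) phi)).
  by apply: deriveN; exact: (tphi.2 _ (coord_xdir i) _ (coord_xdir j) z z0).1.
near=> y; apply: (derive_testN tphi (coord_xdir i)); near: y.
exact: (open_nbhs_nbhs (conj open_pos_time z0)).
Unshelve. all: by end_near. Qed.

Lemma local_minE (A : set ('rV[R]_n * R)) (g : 'rV[R]_n * R -> R) z :
  local_min_on A g z = nbhs z [set y | A y -> g z <= g y].
Proof. by []. Qed.

(** A minimum of [u \- phi] is a maximum of [- u] minus [- phi], and the derivatives of [phi] change
    sign. The envelope may be infinite, so [le_dual] argues by cases. *)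
Lemma supersolutionP F f J u :
  supersolution F f J u <-> esub (dual_env F) (fun x => - f x) J (\- u).
Proof.
have lscE : usc_on (cyl J) (\- u) = lsc_on (cyl J) u.
  by congr lsc_on; apply/funext => z; rewrite /= opprK.
have le_dual (a b : R) (U : \bar R) :
    (b%:E - U <= (- a)%:E)%E = (a%:E <= (- b)%:E + U)%E.
  case: U => [U| |] /=; rewrite ?leey ?leNye//.
  by rewrite !lee_fin; apply/idP/idP; lra.
have oppE phi y : (- phi) y = - phi y by [].
split=> -[H1 H2]; split; rewrite ?lscE// -?lscE//.
  move=> phi z tphi Jz z0; rewrite local_maxE => lmax.
  have := H2 (- phi) z (test_functionN tphi) Jz z0.
  rewrite dtN// gradN// hessN// /dual_env le_dual; apply.
  rewrite local_minE; apply: filterS lmax => y H Jy; have := H Jy.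
  by rewrite /= !oppE; lra.
move=> phi z tphi Jz z0; rewrite local_minE => lmin.
have := H2 (- phi) z (test_functionN tphi) Jz z0.
rewrite dtN// gradN// hessN// /dual_env le_dual /= !opprK; apply.
rewrite local_maxE; apply: filterS lmin => y H Jy; have := H Jy.
by rewrite /= !oppE; lra.
Qed.

End Duality.

(** * A maximum principle with logarithmic penalty *)

Section MaximumPrinciple.
Context {R : realType} {n : nat}.
Implicit Types (G : 'rV[R]_n * 'M[R]_n -> \bar R) (f : 'rV[R]_n -> R).
Implicit Types (u : 'rV[R]_n * R -> R) (z : 'rV[R]_n * R).

Definition logsq (d s : R) : R := d * ln (1 + s ^+ 2).
Definition logsq1 (d s : R) : R := d * (2 * s / (1 + s ^+ 2)).
Definition logsq2 (d s : R) : R := d * (2 * (1 - s ^+ 2) / (1 + s ^+ 2) ^+ 2).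

Let den_gt0 (s : R) : 0 < 1 + s ^+ 2.
Proof. by rewrite ltr_pwDl// sqr_ge0. Qed.

Let dden (s : R) : is_derive s 1 (fun s : R => 1 + s ^+ 2) (2 * s).
Proof.
have := is_derive_pow 1 0 s; rewrite subr0 expr1 => H.
have := is_deriveD (is_derive_cst (1 : R) s 1) H; rewrite add0r.
by congr (is_derive _ _ _ _); apply/funext => y; rewrite fctE /= subr0.
Qed.

Lemma is_derive_logsq (d s : R) : is_derive s 1 (logsq d) (logsq1 d s).
Proof.
apply: (is_deriveMl d (g := fun s => ln (1 + s ^+ 2))).
apply: (is_derive_eq (is_derive1_comp (g := fun s => 1 + s ^+ 2)
  (is_derive1_ln (den_gt0 s)) (dden s))).
by rewrite mulrC.
Qed.

Lemma is_derive_logsq1 (d s : R) : is_derive s 1 (logsq1 d) (logsq2 d s).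
Proof.
apply: (is_deriveMl d (g := fun s => 2 * s / (1 + s ^+ 2))).
have H1 : is_derive s 1 (fun s : R => 2 * s) (2 * 1) by exact: is_deriveMl.
have H2 := is_deriveV (f := fun s => 1 + s ^+ 2) (lt0r_neq0 (den_gt0 s)) (dden s).
apply: (is_derive_eq (is_deriveM H1 H2)).
by rewrite -![_ *: _]/(_ * _); field; rewrite gt_eqF.
Qed.

Lemma continuous_logsq2 (d : R) : continuous (logsq2 d).
Proof.
move=> s; apply: cvgM; first exact: cvg_cst.
have c : {for s, continuous (fun s : R => s ^+ 2)}.
  by apply: cvgM; exact: cvg_id.
have c1 : {for s, continuous (fun s : R => 1 + s ^+ 2)}.
  by apply: cvgD; [exact: cvg_cst|exact: c].
apply: cvgM; last first.
  apply: cvgV; first by rewrite gt_eqF// exprn_gt0.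
  by apply: cvgM; exact: c1.
apply: cvgM; first exact: cvg_cst.
by apply: cvgB; [exact: cvg_cst|exact: c].
Qed.

Lemma logsq1_le (d s : R) : 0 <= d -> `|logsq1 d s| <= d.
Proof.
move=> d0; rewrite /logsq1 normrM (ger0_norm d0) ler_piMr//.
rewrite normrM normfV (gtr0_norm (den_gt0 s)) ler_pdivrMr ?den_gt0// mul1r.
rewrite ler_norml; have := sqr_ge0 (1 + s); have := sqr_ge0 (1 - s).
by rewrite !expr2 => *; apply/andP; split; nra.
Qed.

Lemma logsq2_le (d s : R) : 0 <= d -> `|logsq2 d s| <= 2 * d.
Proof.
move=> d0; rewrite /logsq2 normrM (ger0_norm d0) [leRHS]mulrC ler_wpM2l//.
rewrite normrM normfV (gtr0_norm (exprn_gt0 2 (den_gt0 s))) ler_pdivrMr ?exprn_gt0//.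
have s2 := sqr_ge0 s; set t := s ^+ 2 in s2 *.
by rewrite ler_norml !expr2; apply/andP; split; nra.
Qed.

Lemma logsq_ge0 (d s : R) : 0 <= d -> 0 <= logsq d s.
Proof. by move=> d0; rewrite mulr_ge0// ln_ge0// lerDl sqr_ge0. Qed.

(** Since [1 + s ^+ 2] is at least the absolute value of [s], its logarithm is at least [L / d]. *)
Lemma logsq_large (d s L : R) : 0 < d -> expR (L / d) <= `|s| -> L <= logsq d s.
Proof.
move=> d0 sL; rewrite /logsq mulrC -ler_pdivrMr//.
rewrite -[leLHS]expRK ler_ln ?posrE ?expR_gt0//.
apply: le_trans sL _; rewrite -real_normK ?num_real//.
by have := sqr_ge0 (1 - `|s|); have := normr_ge0 s; rewrite !expr2; nra.
Qed.

Lemma test_function0 : test_function (cst 0 : 'rV[R]_n * R -> R).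
Proof.
have -> : cst 0 = separable (fun=> cst 0) (cst 0) :> ('rV[R]_n * R -> R).
  by apply/funext => z; rewrite /separable big1// addr0.
by apply: (@C2_on_separable _ _ _ (fun=> cst 0) (fun=> cst 0) _ (cst 0) (cst 0)) => *;
  exact: cvg_cst.
Qed.

(* The penalty [d * ln(1 + x_i^2)] makes the maximum attained; as its first and
   second derivatives are bounded by [2d], only the values of [G] near [(0, 0)]
   matter. *)
Lemma esub_le_linear G f u (m T : R) :
  lower_semicontinuous G -> (0 <= G (0%R, 0%R))%E -> continuous f ->
  {within cyl `[0, +oo[, continuous u} -> esub G f `[0, +oo[ u ->
  (forall x, f x <= m) -> (forall x, u (x, 0) <= 0) ->
  bounded_on (cyl `[0, T]) u ->
  forall x t, 0 <= t <= T -> u (x, t) <= m * t.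
Proof.
move=> lG G0 cf cu subu fm u0 [C uC] x1 t1 /andP[t10 t1T].
rewrite leNgt; apply/negP => Hlt.
pose gap := u (x1, t1) - m * t1.
have gap0 : 0 < gap by rewrite subr_gt0.
have t1gt0 : 0 < t1.
  rewrite lt_neqAle t10 andbT; apply/eqP => t1E.
  by move: gap0; rewrite /gap -t1E mulr0; have := u0 x1; lra.
have T0 : 0 < T by exact: lt_le_trans t1gt0 t1T.
(* The extra slope [eps] costs at most a quarter of the gap at time [t1]. *)
pose eps := gap / (4 * T).
have eps0 : 0 < eps by rewrite divr_gt0// mulr_gt0.
have epst1 : eps * t1 <= gap / 4.
  have -> : gap / 4 = eps * T by rewrite /eps; field; rewrite gt_eqF.
  by rewrite ler_wpM2l// ltW.
have [V /nbhs_ballP[e /= e0 He] VG] : exists2 V, nbhs ((0, 0) : 'rV[R]_n * 'M[R]_n) V &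
    forall q, V q -> ((- eps)%:E < G q)%E.
  by apply: lG; apply: lt_le_trans G0; rewrite lte_fin oppr_lt0.
pose S1 := \sum_(i < n) ln (1 + x1 0 i ^+ 2).
have S10 : 0 <= S1 by apply: sumr_ge0 => i _; rewrite ln_ge0// lerDl sqr_ge0.
(* The first bound keeps the derivatives of the penalty within the ball where [G] exceeds [- eps];
   the second makes its value at [x1] cost at most another quarter of the gap. *)
pose d := Num.min (e / 4) (gap / (4 * (S1 + 1))).
have S11 : 0 < S1 + 1 by rewrite ltr_wpDl.
have d0 : 0 < d by rewrite lt_min !divr_gt0// mulr_gt0.
have de : d <= e / 4 by rewrite ge_min lexx.
have dS : d * S1 <= gap / 4.
  have dg : d <= gap / (4 * (S1 + 1)) by rewrite ge_min lexx orbT.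
  have : gap / 4 = gap / (4 * (S1 + 1)) * (S1 + 1) by field; rewrite gt_eqF.
  by move=> ->; apply: ler_pM => //; [exact: ltW|rewrite lerDl].
pose pen : 'rV[R]_n * R -> R := separable (fun=> logsq d) (fun s => (m + eps) * s).
pose h := u \- pen.
have dlin (s : R) : is_derive s 1 (fun s => (m + eps) * s) (m + eps).
  by apply: (is_derive_eq (is_deriveMl (m + eps) (is_derive_id s 1))); rewrite mulr1.
have dcst (s : R) : is_derive s 1 (cst (m + eps)) (cst 0 s) by exact: is_derive_cst.
have ccst : continuous (cst 0 : R -> R) by move=> s; exact: cvg_cst.
have penE y : pen y = \sum_(i < n) logsq d (y.1 0 i) + (m + eps) * y.2 by [].
have h1 : 0 < h (x1, t1).
  rewrite /h /= penE /logsq -mulr_sumr /=; move: gap0 dS epst1.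
  by rewrite /gap -/S1 => *; lra.
(* [L] dominates [u] minus its linear part on the whole strip, so [h] can be positive only where all
   coordinates are at most [r] in absolute value. *)
pose L := C + (`|m| + eps) * T.
pose r := expR (L / d).
have out (y : 'rV[R]_n * R) (i : 'I_n) : cyl `[0, T] y -> r < `|y.1 0 i| -> h y <= 0.
  move=> Cy ry; rewrite /h /= subr_le0 penE (bigD1 i)//=.
  have Li : L <= logsq d (y.1 0 i) by apply: logsq_large => //; exact: ltW.
  have S0 : 0 <= \sum_(j < n | j != i) logsq d (y.1 0 j).
    by apply: sumr_ge0 => j _; apply: logsq_ge0; exact: ltW.
  have uy := le_trans (ler_norm _) (uC y Cy).
  move: Cy; rewrite /cyl/= in_itv/= => /andP[y0 yT].
  have : - ((`|m| + eps) * T) <= (m + eps) * y.2.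
    rewrite lerNl -mulNr; apply: (@le_trans _ _ ((`|m| + eps) * y.2)).
      apply: ler_wpM2r => //; have := ler_norm (- m); rewrite normrN; lra.
    by apply: ler_wpM2l => //; rewrite addr_ge0// ltW.
  by move: Li uy S0; rewrite /L => *; lra.
pose B := [set y : 'rV[R]_n | forall i, `|y 0 i - (0 : 'rV[R]_n) 0 i| <= r] `*`
  `[0, T]%classic.
have cB : compact B by exact: compact_box.
have inB y : cyl `[0, T] y -> 0 < h y -> B y.
  move=> Cy hy; split=> // i; rewrite mxE subr0 leNgt; apply/negP => ry.
  by move: hy; rewrite ltNge (out y i).
have Cz1 : cyl `[0, T] (x1, t1) by rewrite /cyl/= in_itv/= t10.
have B1 : B (x1, t1) by exact: inB.
have cpen : continuous pen.
  move=> y; apply: (@C1_on_continuous _ _ setT) => //; first exact: openT.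
  apply: (C1_on_separable (fun i => is_derive_logsq d) dlin) => [i s|s].
    apply: differentiable_continuous; apply/derivable1_diffP.
    by case: (is_derive_logsq1 d s).
  exact: cvg_cst.
have chB : {within B, continuous h}.
  have c1 : {within B, continuous u}.
    apply: continuous_subspaceW cu => y [_ /=]; rewrite /cyl/= !in_itv/=.
    by case/andP => ->.
  have c2 : {within B, continuous pen} by exact: continuous_subspaceT.
  by move=> y; exact: cvgB (c1 y) (c2 y).
have [y0 By0 maxy0] := @compact_EVT_max _ _ h B (ex_intro _ _ B1) cB chB.
rewrite inE in By0.
have hy0 : 0 < h y0.
  by apply: lt_le_trans h1 _; apply: maxy0; rewrite inE.
have Cy0 : cyl `[0, T] y0 by case: By0.
(* At time 0 both [u] and minus the penalty are nonpositive, whereas [h y0 > 0]. *)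
have y0gt0 : 0 < y0.2.
  have : 0 <= y0.2 by move: Cy0; rewrite /cyl/= in_itv/= => /andP[].
  rewrite le_eqVlt => /orP[/eqP y00|//]; exfalso; move: hy0.
  rewrite /h /= penE -y00 mulr0 addr0 ltNge => /negP; apply.
  rewrite subr_le0; apply: (@le_trans _ _ 0).
    by rewrite [y0]surjective_pairing -y00.
  by apply: sumr_ge0 => j _; apply: logsq_ge0; exact: ltW.
have lm : local_max_on (cyl `[0, T]) (u \- (cst 0 + pen)) y0.
  rewrite local_maxE; apply: filterE => y Cy.
  have E x : (u \- (cst 0 + pen)) x = h x.
    by rewrite /h /=; congr (_ - _); exact: add0r.
  (* Outside [B] one has [h <= 0 < h y0], so the maximum over [B] is one over the whole strip up to
     time [T]. *)
  rewrite !E; have [hy|hy] := ltP 0 (h y); last exact: le_trans hy (ltW hy0).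
  by apply: maxy0; rewrite inE; exact: inB.
have := esub_separable (fun i => is_derive_logsq d) (fun i => is_derive_logsq1 d)
  dlin dcst (fun i => @continuous_logsq2 d) ccst (esub_restrict T lG cf cu subu)
  test_function0 Cy0 y0gt0 lm.
have -> : dt (cst 0 : 'rV[R]_n * R -> R) y0 = 0 by exact: derive_cst.
have -> : grad (cst 0 : 'rV[R]_n * R -> R) y0 = 0.
  by apply/rowP => i; rewrite [LHS]mxE [RHS]mxE; exact: derive_cst.
have -> : hess (cst 0 : 'rV[R]_n * R -> R) y0 = 0.
  apply/matrixP => i j; rewrite [LHS]mxE [RHS]mxE.
  have -> : 'D_(xdir R i) (cst 0 : 'rV[R]_n * R -> R) = cst 0.
    by apply/funext => y; exact: derive_cst.
  exact: derive_cst.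
rewrite !add0r /=; apply/negP; rewrite -ltNge.
(* The test would give [m + eps + G <= f <= m], but [G > - eps] at so small a gradient and
   Hessian. *)
apply: (@le_lt_trans _ _ ((m + eps)%:E + (- eps)%:E)%E).
  by rewrite -EFinD lee_fin addrK.
rewrite lteD2lE//; apply: VG; apply: He; split; split => //= i j.
  rewrite /ball/= !mxE sub0r normrN.
  by apply: le_lt_trans (logsq1_le _ (ltW d0)) _; move: de; lra.
rewrite /ball/= !mxE sub0r normrN.
case: eqP => _; last by rewrite mulr0n normr0.
by rewrite mulr1n; apply: le_lt_trans (logsq2_le _ (ltW d0)) _; move: de; lra.
Qed.

End MaximumPrinciple.

(** * Long time behaviour *)

Section EuclideanNorm.
Context {R : realType} {n : nat}.
Implicit Types x : 'rV[R]_n.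

Lemma enorm_ge0 x : 0 <= enorm x. Proof. exact: sqrtr_ge0. Qed.

Lemma norm_le_enorm x : `|x| <= enorm x.
Proof.
rewrite [leLHS]mx_normrE; apply: bigmax_le => [|[i j] _ /=]; first exact: enorm_ge0.
rewrite (ord1 i) -sqrtr_sqr ler_sqrt; last by apply: sumr_ge0 => k _; exact: sqr_ge0.
by rewrite (bigD1 j)//= lerDl; apply: sumr_ge0 => k _; exact: sqr_ge0.
Qed.

Lemma enorm_le_norm x : enorm x <= Num.sqrt n%:R * `|x|.
Proof.
rewrite -[X in _ * X]ger0_norm// -sqrtr_sqr -sqrtrM ?ler0n// ler_sqrt; last first.
  by rewrite mulr_ge0 ?ler0n ?sqr_ge0.
have -> : n%:R * `|x| ^+ 2 = \sum_(i < n) `|x| ^+ 2.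
  by rewrite sumr_const card_ord mulr_natl.
apply: ler_sum => i _; rewrite -[x 0 i ^+ 2]real_normK ?num_real//.
by rewrite lerXn2r ?nnegrE// norm_coord_le.
Qed.

Lemma enorm_lipschitz_continuous (f : 'rV[R]_n -> R) (L : R) :
  (forall x y, `|f x - f y| <= L * enorm (x - y)) -> continuous f.
Proof.
move=> fL x; pose C := `|L| * Num.sqrt n%:R + 1.
have C0 : 0 < C by rewrite ltr_wpDl// mulr_ge0// sqrtr_ge0.
apply/(@cvgrPdist_le _ _ _ (nbhs x) (nbhs_filter x)) => e e0.
have xC : nbhs x [set y | `|x - y| <= e / C].
  apply/nbhs_ballP; exists (e / C) => [|y]; first by rewrite /= divr_gt0.
  by rewrite mx_norm_ball => /ltW.
apply: (@filterS _ (nbhs x) _ _ _ _ xC) => y xy.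
apply: le_trans (fL x y) _; apply: le_trans (ler_wpM2r (enorm_ge0 _) (ler_norm L)) _.
apply: le_trans (ler_wpM2l (normr_ge0 L) (enorm_le_norm _)) _.
rewrite mulrA; apply: (@le_trans _ _ (C * `|x - y|)); first by rewrite ler_wpM2r// lerDl.
by rewrite mulrC -ler_pdivlMr.
Qed.

End EuclideanNorm.

(* Fekete's lemma; monotonicity handles the times that are not multiples of [s]. *)
Lemma subadditive_rate (R : realType) (U : R -> R) (M : R) :
  (forall t : R, 0 < t -> 0 <= U t <= M * t) ->
  (forall s t : R, 0 < s -> s <= t -> U s <= U t) ->
  (forall s t : R, 0 < s -> 0 < t -> U (s + t) <= U s + U t) ->
  exists2 c : R, 0 <= c <= M &
    forall e : R, 0 < e -> exists2 A : R, 0 < A & forall t, A <= t -> `|U t / t - c| <= e.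
Proof.
move=> UM Umono Usub; pose E := [set U t / t | t in [set t : R | 0 < t]].
have E0 : E !=set0 by exists (U 1 / 1), 1 => //=.
have lbE : lbound E 0.
  by move=> _ [t /= t0 <-]; rewrite divr_ge0// ?(ltW t0)//; case/andP: (UM t t0).
have hE : has_lbound E by exists 0.
have infE (t : R) : 0 < t -> inf E <= U t / t by move=> t0; apply: ge_inf => //; exists t.
exists (inf E); first rewrite lb_le_inf//=.
  apply: le_trans (infE 1 ltr01) _; rewrite divr1.
  by have /andP[_] := UM 1 ltr01; rewrite mulr1.
move=> e e0.
have e2 : 0 < e / 2 by rewrite divr_gt0.
have [_ [s /= s0 <-] Us] := inf_adherent e2 (conj E0 hE).
have Us0 : 0 <= U s by case/andP: (UM s s0).
have Uk (k : nat) : U (k.+1%:R * s) <= k.+1%:R * U s.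
  elim: k => [|k IH]; first by rewrite !mul1r.
  rewrite -[k.+2]addn1 natrD !mulrDl !mul1r.
  by apply: le_trans (Usub _ _ _ _) _; rewrite ?mulr_gt0 ?ltr0Sn// lerD2r.
have UA : 0 <= 2 * U s / e by apply: divr_ge0; [rewrite mulr_ge0|exact: ltW].
(* Beyond this time the rounding error [U s / t] is at most [e / 2]; the other half of [e] is the
   excess of [U s / s] over the infimum. *)
exists (1 + 2 * U s / e) => [|t At]; first by rewrite ltr_pwDl.
have t0 : 0 < t by lra.
rewrite ger0_norm ?subr_ge0 ?infE//.
have ts : 0 <= t / s by rewrite divr_ge0// ltW.
have /andP[k1 k2] := truncn_itv ts; set k := Num.truncn _ in k1 k2.
(* [k + 1] steps of length [s] cover [t], and [k <= t / s]. *)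
have Ut : U t <= (t / s + 1) * U s.
  have tk : t <= k.+1%:R * s by rewrite -ler_pdivrMr// ltW.
  apply: le_trans (Umono _ _ t0 tk) _; apply: le_trans (Uk k) _; apply: ler_wpM2r => //.
  by rewrite -addn1 natrD lerD2r.
have Ust : U s / t <= e / 2.
  rewrite ler_pdivrMr//; have : 2 * U s / e <= t by lra.
  by rewrite ler_pdivrMr//; lra.
have : U t / t <= U s / s + U s / t.
  rewrite ler_pdivrMr//; apply: le_trans Ut _; rewrite le_eqVlt; apply/orP; left; apply/eqP.
  by field; rewrite !gt_eqF.
by move: Us; lra.
Qed.

(** * Consequences of comparison for the Cauchy problem *)

Section CauchyProblem.
Context {R : realType} {n : nat}.
Variables (F : 'rV[R]_n * 'M[R]_n -> R) (f : 'rV[R]_n -> R).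
Hypothesis cf : continuous f.
Hypothesis comparison : forall T : R, 0 < T -> comparison_principle F f T.
Implicit Types (u v w : 'rV[R]_n * R -> R).

Let cfN : continuous (fun x => - f x).
Proof. by move=> x; exact: cvgN (@cf x). Qed.

Lemma cauchy_sub (u0 : 'rV[R]_n -> R) u (T : R) : cauchy_solution F f u0 u ->
  esub (lenv F) f `[0, T] u.
Proof. by move=> [cu su _ _ _]; exact: (esub_restrict T (lenv_lsc (F := F)) cf cu su). Qed.

Lemma cauchy_super (u0 : 'rV[R]_n -> R) u (T : R) : cauchy_solution F f u0 u ->
  esub (dual_env F) (fun x => - f x) `[0, T] (\- u).
Proof.
move=> [cu _ /supersolutionP su _ _].
apply: (esub_restrict T (dual_env_lsc (F := F)) cfN _ su).
by move=> z; exact: cvgN (cu z).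
Qed.

Lemma comparison_esub v w (T : R) : 0 < T ->
  bounded_on (cyl `[0, T]) v -> bounded_on (cyl `[0, T]) w ->
  esub (lenv F) f `[0, T] v -> esub (dual_env F) (fun x => - f x) `[0, T] (\- w) ->
  (forall x, v (x, 0) <= w (x, 0)) ->
  forall x t, 0 <= t <= T -> v (x, t) <= w (x, t).
Proof.
move=> T0 bv bw sv sw vw x t tT; by apply: (comparison T0) => //; exact/supersolutionP.
Qed.

Lemma bounded_concat u v (s T : R) : 0 < s -> 0 <= T ->
  bounded_on (cyl `[0, s + T]) u -> bounded_on (cyl `[0, s + T]) v ->
  bounded_on (cyl `[0, s + T]) (concat s u v).
Proof.
move=> s0 T0 [C uC] [D vD]; exists (Num.max C D) => z Cz; rewrite /concat.
case: ifPn => [zs|]; rewrite le_max; first by rewrite uC.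
rewrite -ltNge => zs; rewrite [X in _ || X]vD ?orbT//.
move: Cz; rewrite /cyl/= !in_itv/= subr_ge0 => /andP[_ zT].
by rewrite (ltW zs)/=; lra.
Qed.

(** The equation does not involve the value of the unknown, so [v + K] is again a supersolution. The
    horizon [t + 1] is positive even for [t = 0]. *)
Lemma cauchy_dist (u0 v0 : 'rV[R]_n -> R) u v (K : R) :
  cauchy_solution F f u0 u -> cauchy_solution F f v0 v ->
  (forall x, u0 x <= v0 x + K) -> forall x t, 0 <= t -> u (x, t) <= v (x, t) + K.
Proof.
move=> hu hv uv x t t0; have t1 : 0 < t + 1 by lra.
have [_ _ _ iu bu] := hu; have [_ _ _ iv bv] := hv.
apply: (@comparison_esub u (fun z => v z + K) (t + 1)) => //.
- exact: bu.
- have [C vC] := bv _ t1; exists (C + `|K|) => z Cz.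
  by apply: le_trans (ler_normD _ _) _; rewrite lerD2r vC.
- exact: cauchy_sub hu.
- have := esub_addc (- K) (cauchy_super (t + 1) hv).
  by congr esub; apply/funext => z /=; rewrite opprD.
- by move=> y; rewrite iu iv.
- by apply/andP; split; lra.
Qed.

Section ZeroData.
Variable u : 'rV[R]_n * R -> R.
Hypothesis hu : cauchy_solution F f (fun=> 0) u.

Let u_init x : u (x, 0) = 0. Proof. by case: hu. Qed.

Let u_bounded (T : R) : 0 < T -> bounded_on (cyl `[0, T]) u.
Proof. by case: hu => _ _ _ _; apply. Qed.

(** As [- f <= 0], the maximum principle with slope 0 applies to [- u]. *)
Lemma cauchy0_ge0 : (forall x, 0 <= f x) -> uenv F (0, 0) = 0%E ->
  forall x t, 0 <= t -> 0 <= u (x, t).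
Proof.
move=> f0 F0 x t t0; have [cu _ /supersolutionP su _ _] := hu.
rewrite -oppr_le0 -[leRHS](mul0r t).
apply: (@esub_le_linear _ _ (dual_env F) (fun x => - f x) (\- u) 0 (t + 1)) => //.
- exact: dual_env_lsc.
- by rewrite /dual_env /= !oppr0 F0 oppe0.
- by move=> z; exact: cvgN (cu z).
- by move=> y; rewrite oppr_le0.
- by move=> y; rewrite /= u_init oppr0.
- have [|C uC] := @u_bounded (t + 1); first by lra.
  by exists C => z Cz; rewrite /= normrN uC.
- by apply/andP; split; lra.
Qed.

Lemma cauchy0_le (M : R) : (forall x, f x <= M) -> lenv F (0, 0) = 0%E ->
  forall x t, 0 <= t -> u (x, t) <= M * t.
Proof.
move=> fM F0 x t t0; have [cu su _ _ _] := hu.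
apply: (@esub_le_linear _ _ (lenv F) f u M (t + 1)) => //.
- exact: lenv_lsc.
- by rewrite F0.
- by move=> y; rewrite u_init.
- by apply: u_bounded; lra.
- by apply/andP; split; lra.
Qed.

(** Following [u] up to time [s] and then starting again from 0 gives a subsolution, because [u] is
    nonnegative at time [s]; comparison puts it below [u]. *)
Lemma cauchy0_mono : (forall x t, 0 <= t -> 0 <= u (x, t)) ->
  forall x s t, 0 < s -> 0 < t -> u (x, t) <= u (x, s + t).
Proof.
move=> uge0 x s t s0 t0.
have st0 : 0 < s + t by rewrite addr_gt0.
have bu := u_bounded st0.
have -> : u (x, t) = concat s u u (x, s + t).
  by rewrite /concat /= leNgt ltrDl t0/= [s + t]addrC addrK.
apply: (@comparison_esub (concat s u u) u (s + t)) => //.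
- by apply: bounded_concat => //; exact: ltW.
- apply: esub_concat => //; [exact: ltW|exact: cauchy_sub hu|exact: cauchy_sub hu|].
  by move=> y; rewrite u_init uge0// ltW.
- exact: cauchy_super hu.
- by move=> y; rewrite /concat /= (ltW s0).
- by rewrite lexx ltW.
Qed.

(** Following [u] up to time [s] and then [u + K] from its start jumps upward at [s], hence gives a
    supersolution; comparison puts it above [u]. *)
Lemma cauchy0_subadd (K s t : R) : 0 < s -> 0 < t ->
  (forall x, u (x, s) <= K) -> forall x, u (x, s + t) <= u (x, t) + K.
Proof.
move=> s0 t0 uK x.
have st0 : 0 < s + t by rewrite addr_gt0.
have bu := u_bounded st0.
pose w := concat s u (fun z => u z + K).
have wE : \- w = concat s (\- u) (fun z => (\- u) z - K).
  by apply/funext => z; rewrite /w /concat /=; case: ifP => // _; rewrite opprD.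
have -> : u (x, t) + K = w (x, s + t).
  by rewrite /w /concat /= leNgt ltrDl t0/= [s + t]addrC addrK.
apply: (@comparison_esub u w (s + t)) => //.
- apply: bounded_concat => //; first exact: ltW.
  have [C uC] := bu; exists (C + `|K|) => z Cz.
  by apply: le_trans (ler_normD _ _) _; rewrite lerD2r uC.
- exact: cauchy_sub hu.
- rewrite wE; apply: esub_concat => //; first exact: ltW.
  + exact: cauchy_super hu.
  + exact: (esub_addc (- K) (cauchy_super t hu)).
  + by move=> y; rewrite /= u_init oppr0 sub0r lerN2.
- by move=> y; rewrite /w /concat /= (ltW s0).
- by rewrite lexx ltW.
Qed.

End ZeroData.
End CauchyProblem.

(** * Convergence of the long time average *)

Lemma BUC_cst0 (R : realType) (n : nat) : @BUC R n (fun=> 0).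
Proof.
split; first by exists 0 => z _; rewrite normr0.
move=> E entE.
suff : entourage ((fun=> (0, 0)) @^-1` E : set ('rV[R]_n * 'rV[R]_n)) by [].
rewrite (_ : _ @^-1` _ = setT); first exact: entourageT.
by apply/seteqP; split => // x _; exact: entourage_refl.
Qed.

Lemma cvg_uniform_dist (R : realType) (T : choiceType) (K : set T) (g : R -> T -> R) (c : R) :
  (forall e : R, 0 < e -> exists A : R, forall t, A <= t ->
    forall x, K x -> `|g t x - c| < e) ->
  {uniform K, g @ +oo --> cst c}.
Proof.
move=> H P /uniform_nbhs[E [entE EP]].
have [e /= e0 He] : exists2 e : R, 0 < e & forall a b : R, `|a - b| < e -> E (a, b).
  move: entE; rewrite -entourage_ballE => -[e /= e0 He].
  by exists e => // a b ab; apply: He; rewrite -ball_normE.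
have [A HA] := H e e0.
exists A; split; first exact: num_real.
move=> t /ltW At; apply: EP => x Kx.
by apply: He; rewrite distrC; exact: HA.
Qed.

Theorem theorem3p3 (R : realType) (n : nat)
  (F : 'rV[R]_n * 'M[R]_n -> R) (f : 'rV[R]_n -> R) (M : R)
  (F_cont : {within @Fdom R n, continuous F})
  (F_ell : degenerate_elliptic F)
  (F_lenv0 : lenv F (0, 0) = 0%E)
  (F_uenv0 : uenv F (0, 0) = 0%E)
  (f_ge0 : forall x, 0 <= f x)
  (f_lip : exists L : R, forall x y, `|f x - f y| <= L * enorm (x - y))
  (f_max : (exists x, f x = M) /\ forall x, f x <= M)
  (A1_comparison : forall T : R, 0 < T -> comparison_principle F f T)
  (A1_existence : forall u0 : 'rV[R]_n -> R, BUC u0 ->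
    exists u : 'rV[R]_n * R -> R, cauchy_solution F f u0 u)
  (A2 : forall u : 'rV[R]_n * R -> R, cauchy_solution F f (fun=> 0) u ->
    exists w : R -> R,
      [/\ {within `[0, +oo[, continuous w},
          {in `[0, +oo[ &, {homo w : r s / r < s}},
          forall r, 0 <= r -> 0 <= w r,
          w 0 = 0 &
          forall (x y : 'rV[R]_n) (t : R), 0 <= t ->
            `|u (x, t) - u (y, t)| <= w (enorm (x - y))])
  (A3 : forall u : 'rV[R]_n * R -> R, cauchy_solution F f (fun=> 0) u ->
    exists2 R0 : R, 0 < R0 & forall T : R, 0 < T ->
      exists (xT : 'rV[R]_n) (sT : R),
        [/\ enorm xT <= R0, 0 <= sT <= T &
            forall (x : 'rV[R]_n) (t : R), 0 <= t <= T ->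
              u (x, t) <= u (xT, sT)]) :
  exists2 c : R, 0 <= c <= M &
    forall (u0 : 'rV[R]_n -> R) (u : 'rV[R]_n * R -> R),
      BUC u0 -> cauchy_solution F f u0 u ->
      forall K : set 'rV[R]_n, compact K ->
        {uniform K, (fun (t : R) (x : 'rV[R]_n) => u (x, t) / t) @ +oo --> cst c}.
Proof.
have [L fL] := f_lip; have cf := enorm_lipschitz_continuous fL.
have fM := f_max.2.
have [u hu] := A1_existence _ (BUC_cst0 R n).
have [w [_ w_incr w_ge0 _ uw]] := A2 u hu.
have [R0 R0_gt0 umax] := A3 u hu.
have uge0 : forall x t, 0 <= t -> 0 <= u (x, t) := cauchy0_ge0 cf hu f_ge0 F_uenv0.
have uleM : forall x t, 0 <= t -> u (x, t) <= M * t := cauchy0_le cf hu fM F_lenv0.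
have umono := cauchy0_mono cf A1_comparison hu uge0.
(* Monotonicity in time moves the maximum point of (A3) on [[0, T]] up to time [T] without leaving
   the ball; if it lies at time 0, [u] being 0 there, nonnegativity does the same. *)
have /choice[X XP] : forall T : R, exists x, 0 < T ->
    enorm x <= R0 /\ forall y, u (y, T) <= u (x, T).
  move=> T; have [T0|T0] := ltP 0 T; last by exists 0.
  have [x [s [xR /andP[s0 sT] xmax]]] := umax T T0; exists x => _; split=> // y.
  apply: (@le_trans _ _ (u (x, s))); first by apply: xmax; rewrite ltW/=.
  move: sT; rewrite le_eqVlt => /orP[/eqP ->//|sT].
  move: s0; rewrite le_eqVlt => /orP[/eqP <-|s0].
    by have [_ _ _ -> _] := hu; apply: uge0; exact: ltW.
  have Ts0 : 0 < T - s by rewrite subr_gt0.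
  by have := umono x _ _ Ts0 s0; rewrite subrK.
pose U t := u (X t, t).
have [||s t s0 t0|c cM Uc] := @subadditive_rate R U M.
- by move=> t t0; rewrite uge0 ?uleM ?ltW.
- move=> s t s0; rewrite le_eqVlt => /orP[/eqP ->//|st].
  have t0 := lt_trans s0 st; apply: (@le_trans _ _ (u (X s, t))).
    have ts0 : 0 < t - s by rewrite subr_gt0.
    by have := umono (X s) _ _ ts0 s0; rewrite subrK.
  exact: (XP t t0).2.
- have H := cauchy0_subadd cf A1_comparison hu s0 t0 (XP s s0).2 (X (s + t)).
  by apply: le_trans H _; rewrite [leRHS]addrC lerD2r; exact: (XP t t0).2.
exists c => // u0 v [[C u0C] _] hv K cK.
have [B B0 KB] : exists2 B : R, 0 < B & forall x, K x -> `|x| <= B.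
  have [B [_ HB]] := compact_bounded cK.
  exists (`|B| + 1) => [|x Kx]; first by rewrite ltr_wpDl.
  by apply: HB Kx; have := ler_norm B; lra.
(* [D] bounds the Euclidean distance from points of [K] to all [X t]; the 1 makes the bound strict,
   as [w_incr] requires. *)
pose D := Num.sqrt n%:R * (B + R0) + 1.
have D0 : 0 < D by rewrite ltr_wpDl// mulr_ge0 ?sqrtr_ge0// addr_ge0 ?ltW.
have uU x t : K x -> 0 < t -> `|u (x, t) - U t| <= w D.
  move=> Kx t0; apply: le_trans (uw _ _ _ (ltW t0)) _.
  apply/ltW/w_incr; rewrite ?in_itv/= ?andbT ?enorm_ge0 ?(ltW D0)//.
  apply: le_lt_trans (enorm_le_norm _) _; rewrite /D ltr_pwDr//.
  apply: ler_wpM2l; first exact: sqrtr_ge0.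
  apply: le_trans (ler_normB _ _) _; apply: lerD; first exact: KB.
  exact: le_trans (norm_le_enorm _) (XP t t0).1.
have vu x t : 0 <= t -> `|v (x, t) - u (x, t)| <= C.
  move=> t0; rewrite ler_distl lerBlDr; apply/andP; split.
    apply: (cauchy_dist cf A1_comparison hu hv) => // y.
    have := u0C y Logic.I; rewrite ler_norml => /andP[]; lra.
  apply: (cauchy_dist cf A1_comparison hv hu) => // y.
  by have := u0C y Logic.I; rewrite ler_norml add0r => /andP[].
apply: cvg_uniform_dist => e e0.
have e3 : 0 < e / 3 by rewrite divr_gt0.
have [A A0 HA] := Uc _ e3.
have C0 : 0 <= C by exact: le_trans (normr_ge0 _) (u0C 0 Logic.I).
have W0 : 0 <= C + w D by rewrite addr_ge0// w_ge0// ltW.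
(* From this time on, both [U t / t - c] and the error [(C + w D) / t] are at most [e / 3] in
   absolute value, so the sum stays strictly below [e]. *)
exists (A + (C + w D) / (e / 3)) => t At x Kx.
have q0 : 0 <= (C + w D) / (e / 3) by rewrite divr_ge0// ltW.
have t0 : 0 < t by lra.
have tA : A <= t by lra.
have st : (C + w D) / t <= e / 3.
  rewrite ler_pdivrMr// mulrC -ler_pdivrMr//; lra.
have -> : v (x, t) / t - c =
    (v (x, t) - u (x, t)) / t + (u (x, t) - U t) / t + (U t / t - c).
  by field; rewrite gt_eqF.
apply: le_lt_trans (ler_normD _ _) _.
have h1 : `|(v (x, t) - u (x, t)) / t + (u (x, t) - U t) / t| <= (C + w D) / t.
  rewrite -mulrDl normrM normfV (gtr0_norm t0).
  apply: ler_wpM2r; first by rewrite invr_ge0 ltW.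
  apply: le_trans (ler_normD _ _) _; apply: lerD; first exact: vu (ltW t0).
  exact: uU.
by have := HA t tA; lra.
Qed.
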